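(* Let $\mathcal{X}=(X,d_X,\pi_X,\mu_X)$ and $\mathcal{Y}=(Y,d_Y,\pi_Y,\mu_Y)$ be bounded $mm$-fields over $B$. Then $$d_{GW,\infty}(\mathcal{X},\mathcal{Y})=\inf_{(x_n)\in U_X,\ (y_n)\in U_Y}\max\left\{\frac12\sup_{i,j}m_{X,Y}(x_i,y_i,x_j,y_j),\ \sup_i d_{X,Y}(x_i,y_i)\right\}.$$ Furthermore, there are sequences $(x_n)\in U_X$ and $(y_n)\in U_Y$ that realize the infimum on the right-hand side.
   Context: A Polish space means a complete separable metric space. An $mm$-field over a Polish space $(B,d_B)$ is a tuple consisting of a Polish space $(X,d_X)$, a $1$-Lipschitz map $\pi_X\colon X\to B$ and a Borel probability measure $\mu_X$ on $X$. It is bounded if $X$ has finite diameter. For $mm$-fields $\mathcal{X},\mathcal{Y}$ over $B$ put $m_{X,Y}(x,y,x',y'):=|d_X(x,x')-d_Y(y,y')|$ and $d_{X,Y}(x,y):=d_B(\pi_X(x),\pi_Y(y))$. Let $C(\mu_X,\mu_Y)$ be the set of couplings, i.e. Borel probability measures on $X\times Y$ with marginals $\mu_X$ and $\mu_Y$. Then $$d_{GW,\infty}(\mathcal{X},\mathcal{Y}):=\inf_{P\in C(\mu_X,\mu_Y)}\max\left\{\frac12\sup_{\mathrm{supp}(P\otimes P)}m_{X,Y},\ \sup_{\mathrm{supp}P}d_{X,Y}\right\}.$$ $U_X$ is the set of uniformly distributed sequences in $X$: sequences $(x_n)_{n\ge1}$ in $X$ such that $\frac1n\sum_{i=1}^n\delta_{x_i}\to\mu_X$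 weakly as $n\to\infty$. $U_Y$ is defined analogously. *)

(* Defs.v *)
From HB Require Import structures.
From mathcomp Require Import all_boot all_order all_algebra.
From mathcomp Require Import all_classical all_reals all_analysis.

Set Implicit Arguments.
Unset Strict Implicit.
Unset Printing Implicit Defensive.

Import Order.TTheory GRing.Theory Num.Theory.
Import numFieldNormedType.Exports.

Local Open Scope classical_set_scope.
Local Open Scope ring_scope.

Definition separable (T : topologicalType) : Prop :=
  exists2 D : set T, countable D & dense D.

HB.mixin Record isSeparable T & Topological T := {
  separableT : separable T
}.

(* [Complete] (like every measurable type) is pointed. This is no restriction
   here: a space carrying a probability measure is nonempty, and so is the base
   of an mm-field. The distinguished point is never used. *)
#[short(type="polishType")]
HB.structure Definition Polish (R : realType) :=
  {T of Metric R T & Complete T & isSeparable T}.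

(* [T] equipped with its Borel sigma-algebra; it is convertible to [T]. *)
Notation borel T := (g_sigma_algebraType (@open T)).

Record mmField (R : realType) (B : polishType R) := MMField {
  mm_space :> polishType R ;
  mm_proj : mm_space -> B ;
  mm_proj_lip : forall x x' : mm_space,
    mdist (mm_proj x) (mm_proj x') <= mdist x x' ;
  mm_meas : probability (borel mm_space) R
}.

Definition diam (R : realType) (T : metricType R) : \bar R :=
  ereal_sup [set (mdist p.1 p.2)%:E | p in [set: T * T]].

Definition bounded_mmField (R : realType) (B : polishType R) (X : mmField B) :=
  (diam X < +oo)%E.

(* [mu] is only required to be a set function so that [supp] applies to [P \x P],
   which lives on a product sigma-algebra; that sigma-algebra contains the open
   sets by second countability. *)
Definition supp (R : realType) (T : topologicalType) (mu : set T -> \bar R) :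
    set T :=
  [set x | forall U : set T, open_nbhs x U -> (0 < mu U)%E].

Definition couplings (R : realType) (S T : ptopologicalType)
    (mu : probability (borel S) R) (nu : probability (borel T) R) :
    set (probability (borel (S * T)%type) R) :=
  [set P : probability (borel (S * T)%type) R |
    (forall A : set (borel S), measurable A -> P (fst @^-1` A) = mu A) /\
    (forall A : set (borel T), measurable A -> P (snd @^-1` A) = nu A)].

Definition weak_cvg (R : realType) (T : ptopologicalType)
    (mu_ : nat -> {measure set (borel T) -> \bar R})
    (mu : {measure set (borel T) -> \bar R}) : Prop :=
  forall f : T -> R, continuous f -> bounded_fun f ->
    (\int[mu_ n]_(x in [set: borel T]) (f x)%:E)%E @[n --> \oo]
      --> (\int[mu]_(x in [set: borel T]) (f x)%:E)%E.

(* n^-1 (\d_(x 0) + ... + \d_(x n.-1)); sequences are indexed from 0, and the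
   value at n = 0 (the zero measure) is irrelevant to the limit. *)
Definition empirical (R : realType) (T : ptopologicalType) (x : nat -> T)
    (n : nat) : {measure set (borel T) -> \bar R} :=
  mscale (n%:R^-1)%:nng (msum (fun i => \d_(x i : borel T)) n).

Section GromovWasserstein.
Context (R : realType) (B : polishType R).

Definition unif_seq (X : mmField B) : set (nat -> X) :=
  [set x | weak_cvg (@empirical R X x) (mm_meas X)].

Variables X Y : mmField B.

Definition mXY (x : X) (y : Y) (x' : X) (y' : Y) : R :=
  `|mdist x x' - mdist y y'|.

Definition dXY (x : X) (y : Y) : R := mdist (mm_proj x) (mm_proj y).

Definition coupling_cost (P : probability (borel (X * Y)%type) R) : \bar R :=
  Order.max
    ((2^-1)%:E * ereal_sup [set (mXY z.1.1 z.1.2 z.2.1 z.2.2)%:E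
                           | z in @supp R ((X * Y) * (X * Y))%type (P \x P)])%E
    (ereal_sup [set (dXY z.1 z.2)%:E | z in @supp R (X * Y)%type P]).

Definition dGWoo : \bar R :=
  ereal_inf [set coupling_cost P | P in couplings (mm_meas X) (mm_meas Y)].

Definition seq_cost (x : nat -> X) (y : nat -> Y) : \bar R :=
  Order.max
    ((2^-1)%:E * ereal_sup [set (mXY (x p.1) (y p.1) (x p.2) (y p.2))%:E
                           | p in [set: nat * nat]])%E
    (ereal_sup [set (dXY (x i) (y i))%:E | i in [set: nat]]).

End GromovWasserstein.

(* Main.v *)
Require Import Defs.
From HB Require Import structures.
From mathcomp Require Import all_boot all_order all_algebra.
From mathcomp Require Import all_classical all_reals all_analysis.
From mathcomp Require Import measurable_realfun ring lra.

Set Implicit Arguments.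
Unset Strict Implicit.
Unset Printing Implicit Defensive.

Import Order.TTheory GRing.Theory Num.Theory.
Import numFieldNormedType.Exports.

Local Open Scope classical_set_scope.
Local Open Scope ring_scope.

(** Both inequalities between the two infima, and the attainment of the second,
    come from two constructions.

    From couplings to sequences. Every Borel probability [P] on a second countable
    space admits a uniformly distributed sequence that lies in the support of [P]
    ([unif_seq_in_supp]). The sequence is built greedily, each point being chosen
    to correct the accumulated deviations of countably many frequencies. Applied
    to a coupling of the two measures, it yields pairs [(x i, y i)] in the
    support of the coupling; the coordinates are uniformly distributed, and the
    cost of the sequences is at most the cost of the coupling.

    From sequences to couplings. Take pairs of uniformly distributed sequences
    whose costs tend to the infimum. Their empirical averages on the product have
    a limit along an ultrafilter, a finitely additive mean defined on all bounded
    functions, which agrees with the given measures on bounded continuous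
    functions of one coordinate.
    Tightness of these two measures makes the mean tight, and a tight mean is
    represented, on Lipschitz functions, by a Borel probability
    ([tight_mean_riesz]). To see the latter, split the space repeatedly along
    small balls, and split the unit interval in parallel into intervals whose
    lengths are the masses that the mean gives to the cells: almost every point
    of the interval selects a decreasing sequence of cells of diameter tending to
    zero, hence a point of the complete space, and the law of this point under the
    uniform measure is the probability sought. Lipschitz functions determine the
    marginals, so the probability is a coupling ([coupling_of_sequences]); two
    points of its support are approximated by pairs of one and the same sequence
    of small cost, so the cost of the coupling is at most the infimum over
    sequences.

    Applying the first construction to the coupling given by the second one
    produces sequences that realize the infimum. *)

(** * Finitely additive means *)

Definition bdd (R : realType) (T : Type) (f : T -> R) :=
  exists M, forall x, `|f x| <= M.

(** A finitely additive probability, seen as an integral defined on all bounded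
    functions. Limits of empirical averages along an ultrafilter are of this kind;
    what they may lose is countable additivity. *)
Record is_mean (R : realType) (T : Type) (L : (T -> R) -> R) : Prop := IsMean {
  meanD : forall f g, bdd f -> bdd g -> L (fun x => f x + g x) = L f + L g ;
  meanZ : forall c f, bdd f -> L (fun x => c * f x) = c * L f ;
  mean_le : forall f g, bdd f -> bdd g -> (forall x, f x <= g x) -> L f <= L g ;
  mean1 : L (fun=> 1) = 1 }.

Section mean_theory.
Context (R : realType) (T : Type).
Implicit Types (f g : T -> R) (L : (T -> R) -> R).

Lemma bdd_cst c : bdd (fun _ : T => c : R).
Proof. by exists `|c|. Qed.

Lemma bddD f g : bdd f -> bdd g -> bdd (fun x => f x + g x).
Proof.
move=> [M fM] [N gN]; exists (M + N) => x.
by rewrite (le_trans (ler_normD _ _))// lerD.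
Qed.

Lemma bddZ c f : bdd f -> bdd (fun x => c * f x).
Proof.
by move=> [M fM]; exists (`|c| * M) => x; rewrite normrM ler_wpM2l.
Qed.

Lemma bdd_01 f : (forall x, 0 <= f x <= 1) -> bdd f.
Proof.
by move=> f01; exists 1 => x; have /andP[? ?] := f01 x; rewrite ger0_norm.
Qed.

Lemma bdd_indic (A : set T) : bdd (\1_A : T -> R).
Proof.
by apply: bdd_01 => x; rewrite indicE; case: (_ \in _); rewrite lexx ler01.
Qed.

Lemma bdd_sum (I : Type) (s : seq I) (F : I -> T -> R) :
  (forall i, bdd (F i)) -> bdd (fun x => \sum_(i <- s) F i x).
Proof.
move=> bF; elim: s => [|i s ih].
  by under eq_fun do rewrite big_nil; exact: bdd_cst.
by under eq_fun do rewrite big_cons; exact: bddD.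
Qed.

Lemma mean_cst L c : is_mean L -> L (fun=> c) = c.
Proof.
move=> mL; rewrite -[RHS]mulr1 -(mean1 mL) -(meanZ mL) ?mulr1//.
exact: bdd_cst.
Qed.

Lemma mean_ge0 L f : is_mean L -> bdd f -> (forall x, 0 <= f x) -> 0 <= L f.
Proof.
by move=> mL bf f0; rewrite -(mean_cst 0 mL); apply: mean_le => //; exact: bdd_cst.
Qed.

Lemma mean_sum L (I : Type) (s : seq I) (F : I -> T -> R) : is_mean L ->
  (forall i, bdd (F i)) -> L (fun x => \sum_(i <- s) F i x) = \sum_(i <- s) L (F i).
Proof.
move=> mL bF; elim: s => [|i s ih].
  by under eq_fun do rewrite big_nil; rewrite big_nil mean_cst.
under eq_fun do rewrite big_cons; rewrite big_cons meanD// ?ih//.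
exact: bdd_sum.
Qed.

End mean_theory.

(** * Splitting the unit interval along a mean *)

Lemma probability_setI1 d (T : measurableType d) (R : realType)
    (P : probability T R) (A B : set T) :
  measurable A -> measurable B -> P B = 1%E -> P (A `&` B) = P A.
Proof.
move=> mA mB PB; rewrite [RHS](measureDI P mA mB).
rewrite [X in (_ = X + _)%E](_ : _ = 0%E) ?add0e//.
apply/eqP; rewrite eq_le measure_ge0 andbT -(subee (_ : 1%E \is a fin_num))//.
rewrite -[X in (_ <= _ - X)%E]PB -probability_setC//.
apply: le_measure; rewrite ?inE//.
- exact: measurableD.
- exact: measurableC.
Qed.

Section uniform_measure.
Context (R : realType).

Let U : probability (measurableTypeR R) R := @uniform_prob R 0 1 ltr01.

Lemma uniform_itv (a b : R) : 0 <= a -> a <= b -> b <= 1 ->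
  U `[a, b[%classic = (b - a)%:E.
Proof.
move=> a0 ab b1.
rewrite /U /= /uniform_prob integral_uniform_pdf.
rewrite (_ : _ `&` _ = `[a, b[%classic); last first.
  apply/seteqP; split=> x /=; first by case.
  rewrite !in_itv/= => /andP[h1 h2]; split=> //; first by rewrite h1.
  by rewrite (le_trans a0)//= (le_trans (ltW h2)).
rewrite (eq_integral (cst 1%E)); last first.
  move=> x; rewrite inE/= in_itv/= => /andP[h1 h2].
  rewrite /uniform_pdf (le_trans a0 h1)/= (le_trans (ltW h2))//=.
  by rewrite subr0 invr1.
rewrite integral_cst//= mul1e lebesgue_measure_itv/= lte_fin.
case: ltP => // ba; rewrite (_ : b = a) ?subrr//.
by apply/eqP; rewrite eq_le ab ba.
Qed.

Lemma uniform01 : U `[0, 1[%classic = 1%E.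
Proof. by rewrite uniform_itv// subr0. Qed.

End uniform_measure.

(** A mean [L] on the functions on [T] is turned into a random walk. The sets
    [A 0, A 1, ...] sort the points of [T] into cells: the address of [z] records
    which of the first [m] sets contain [z], the latest answer first. A cell [s]
    weighs [L \1_(cell s)], and finite additivity of [L] is exactly what is needed
    to give the cells disjoint subintervals of [0, 1[ of these lengths, each cell
    sharing its interval between its two refinements. The cell of depth [m] whose
    interval contains [t] is [branch t m]; under the uniform law, [branch ^~ m] is
    then distributed like the address under [L]. *)
Section coding.
Context (R : realType) (T : ptopologicalType) (A : nat -> set T).
Variables (L : (T -> R) -> R) (mL : is_mean L).

Fixpoint address m (z : T) : seq bool :=
  if m is m'.+1 then (z \in A m') :: address m' z else [::].

Definition cell s : set T := [set z | address (size s) z = s].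

Definition mass s : R := L \1_(cell s).

Fixpoint left_end s : R :=
  if s is b :: s' then
    left_end s' + (if b then mass (false :: s') else 0)
  else 0.

Fixpoint branch (t : R) m : seq bool :=
  if m is m'.+1 then
    let s := branch t m' in (left_end s + mass (false :: s) <= t) :: s
  else [::].

Definition rep s : T := xget point (cell s).

Lemma size_address m z : size (address m z) = m.
Proof. by elim: m => //= m ->. Qed.

Lemma size_branch t m : size (branch t m) = m.
Proof. by elim: m => //= m ->. Qed.

Lemma mass_ge0 s : 0 <= mass s.
Proof. by apply: mean_ge0 => //; exact: bdd_indic. Qed.

Lemma mass_nil : mass [::] = 1.
Proof.
rewrite /mass (_ : cell [::] = setT) ?indicT; last by apply/seteqP; split.
exact: mean1 mL.
Qed.

Lemma mass_split s : mass s = mass (false :: s) + mass (true :: s).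
Proof.
rewrite /mass -(meanD mL); [|exact: bdd_indic..]; congr L; apply/funext => z.
rewrite !indicE -[RHS]natrD; congr (_%:R).
have addressE b s' : (z \in cell (b :: s')) =
    ((z \in A (size s')) == b) && (z \in cell s').
  apply/idP/andP => [|[/eqP <-]]; rewrite !inE/cell/=; first by case=> -> ->.
  by move=> ->.
by rewrite !addressE; case: (z \in A _); case: (z \in cell s).
Qed.

Lemma branch_itv t m : 0 <= t < 1 ->
  left_end (branch t m) <= t < left_end (branch t m) + mass (branch t m).
Proof.
move=> t01; elim: m => [|m /andP[ih1 ih2]] /=; first by rewrite mass_nil add0r.
case: (leP (left_end _ + mass (false :: _)) t) => h.
  by rewrite h/= -addrA -mass_split.
by rewrite addr0 ih1.
Qed.

(** The converse of [branch_itv]: the intervals of the cells of the same depth are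
    disjoint. *)
Lemma itv_branch t s : left_end s <= t < left_end s + mass s ->
  branch t (size s) = s.
Proof.
elim: s => [//|b s ih] /= /andP[h1 h2].
have st : branch t (size s) = s.
  apply: ih; rewrite mass_split.
  have := mass_ge0 (false :: s); have := mass_ge0 (true :: s).
  by case: b h1 h2 => h1 h2 m1 m2; apply/andP; split; lra.
rewrite st; congr (_ :: _); case: b h1 h2 => h1 h2; first by rewrite h1.
by apply/negbTE; rewrite -ltNge -(addr0 (left_end s)).
Qed.

Lemma left_end_ge0 s : 0 <= left_end s.
Proof.
elim: s => //= b s ih; rewrite addr_ge0//.
by case: b => //; exact: mass_ge0.
Qed.

Lemma right_end_le1 s : left_end s + mass s <= 1.
Proof.
elim: s => [|b s ih] /=; first by rewrite add0r mass_nil.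
move: ih; rewrite (mass_split s).
have := mass_ge0 (false :: s); have := mass_ge0 (true :: s).
by case: b => *; lra.
Qed.

(** The walk never enters an empty cell, as such a cell gets an empty interval. *)
Lemma branch_cell t m : 0 <= t < 1 -> cell (branch t m) (rep (branch t m)).
Proof.
move=> /(@branch_itv _ m) /andP[h1 h2].
have m0 : mass (branch t m) != 0 by rewrite gt_eqF//; lra.
rewrite /rep; case: xgetP => [//|] h; exfalso; move/eqP: m0; apply.
rewrite /mass (_ : cell _ = set0) ?indic0 ?(mean_cst _ mL)//.
by apply/seteqP; split => // z /h.
Qed.

Lemma address_rep t m : 0 <= t < 1 -> address m (rep (branch t m)) = branch t m.
Proof. by move=> /(@branch_cell _ m); rewrite /cell /= size_branch. Qed.

Lemma address_rep_address m z : address m (rep (address m z)) = address m z.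
Proof.
have : cell (address m z) (rep (address m z)).
  by rewrite /rep; apply: xgetPex; exists z; rewrite /cell /= size_address.
by rewrite /cell /= size_address.
Qed.

Lemma address_eq_test m k z z' : (k < m)%N -> address m z = address m z' ->
  A k z <-> A k z'.
Proof.
elim: m => //= m ih; rewrite ltnS leq_eqVlt => /orP[/eqP ->|km] [e1 e2].
  by split => h; apply/set_mem; [rewrite -e1|rewrite e1]; exact/mem_set.
exact: ih.
Qed.

Lemma address_branchW t m k z : (k <= m)%N -> address m z = branch t m ->
  address k z = branch t k.
Proof.
elim: m => [|m ih]; first by rewrite leqn0 => /eqP ->.
by rewrite leq_eqVlt => /orP[/eqP -> //|]; rewrite ltnS => km [_ /(ih km)].
Qed.

Lemma measurable_branch_eq s m :
  measurable [set t : measurableTypeR R | branch t m = s].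
Proof.
elim: m s => [|m ih] [|b s] /=.
- by rewrite (_ : [set _ | _] = setT)//; apply/seteqP; split.
- by rewrite (_ : [set _ | _] = set0)//; apply/seteqP; split.
- by rewrite (_ : [set _ | _] = set0)//; apply/seteqP; split.
rewrite (_ : [set _ | _] = [set t | branch t m = s] `&`
   [set` if b then `[left_end s + mass (false :: s), +oo[
      else `]-oo, left_end s + mass (false :: s)[]); last first.
  apply/seteqP; split => t /=.
    by move=> [<- <-]; split=> //; case: leP => h /=; rewrite in_itv/= ?andbT.
  move=> [-> +]; case: b; rewrite /= in_itv/= ?andbT => h; first by rewrite h.
  by rewrite leNgt h.
by apply: measurableI => //; case: b.
Qed.

Lemma measurable_branch (S : set (seq bool)) m :
  measurable [set t : measurableTypeR R | S (branch t m)].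
Proof.
pose F n : set (measurableTypeR R) :=
  if (unpickle n : option (seq bool)) is Some s then
    if s \in S then [set t | branch t m = s] else set0
  else set0.
have mF n : measurable (F n).
  rewrite /F; case: (unpickle n) => [s|]//.
  by case: ifP => // _; exact: measurable_branch_eq.
suff -> : [set t : measurableTypeR R | S (branch t m)] = \bigcup_n F n.
  by apply: bigcupT_measurable.
apply/seteqP; split => t /=.
  by move=> St; exists (pickle (branch t m)); rewrite // /F pickleK mem_set.
move=> [n _]; rewrite /F; case: (unpickle n) => [s|]//.
by case: ifP => //=; rewrite inE => ? ->.
Qed.

Let U : probability (measurableTypeR R) R := @uniform_prob R 0 1 ltr01.

Lemma measure_branch s : U [set t | branch t (size s) = s] = (mass s)%:E.
Proof.
rewrite -[LHS](probability_setI1 _ _ (uniform01 R))//; last first.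
  exact: measurable_branch_eq.
rewrite (_ : _ `&` _ = `[left_end s, left_end s + mass s[%classic); last first.
  apply/seteqP; split => t /=; rewrite !in_itv/=.
    by move=> [e /(@branch_itv _ (size s))]; rewrite e.
  move=> h; split; first exact: itv_branch.
  have /andP[h1 h2] := h; rewrite (le_trans (left_end_ge0 s))//=.
  by rewrite (lt_le_trans h2)// right_end_le1.
rewrite uniform_itv ?left_end_ge0 ?right_end_le1 ?lerDl ?mass_ge0//.
by rewrite addrC addKr.
Qed.

(** The walk has the law of the address, so a function of the address can be
    averaged by a genuine integral. *)
Lemma integral_branch (g : seq bool -> R) m : (forall s, 0 <= g s) ->
  (\int[U]_t (g (branch t m))%:E)%E = (L (fun z => g (address m z)))%:E.
Proof.
move=> g0.
have branchE t : g (branch t m) =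
    \sum_(s : m.-tuple bool) g s * \1_[set t | branch t m = s] t.
  have sp : size (branch t m) == m by rewrite size_branch.
  rewrite (bigD1 (Tuple sp))//= indicE mem_set// mulr1 big1 ?addr0// => s.
  move=> /eqP ns; rewrite indicE memNset ?mulr0// => /= e; apply: ns.
  exact/val_inj.
have -> : (fun z => g (address m z)) =
    fun z => \sum_(s : m.-tuple bool) g s * \1_(cell s) z.
  apply/funext => z.
  have sp : size (address m z) == m by rewrite size_address.
  rewrite (bigD1 (Tuple sp))//= indicE mem_set ?mulr1; last first.
    by rewrite /cell /= size_address.
  rewrite big1 ?addr0// => s /eqP ns.
  rewrite indicE memNset ?mulr0//= /cell/= size_tuple => e; apply: ns.
  exact/val_inj.
under eq_integral do rewrite branchE -sumEFin.
rewrite ge0_integral_sum//; last 2 first.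
- move=> s; apply/measurable_EFinP; apply: measurable_funM => //.
  by apply: measurable_indic; exact: measurable_branch_eq.
- by move=> s t _; rewrite lee_fin mulr_ge0// indicE.
rewrite mean_sum//; last by move=> s; apply: bddZ; exact: bdd_indic.
rewrite -sumEFin; apply: eq_bigr => s _.
under eq_integral do rewrite EFinM.
rewrite ge0_integralZl//; last 2 first.
- apply/measurable_EFinP.
  by apply: measurable_indic; exact: measurable_branch_eq.
- by rewrite lee_fin.
rewrite integral_indic//; last exact: measurable_branch_eq.
rewrite setIT (meanZ mL) ?EFinM; last exact: bdd_indic.
by rewrite -measure_branch size_tuple.
Qed.

End coding.

(** * Completeness of products *)

(* The weakest structures come first: the first product instance declared for a
   structure is the one that inference retains. *)
HB.instance Definition _ (S T : pnbhsType) := Nbhs.on (S * T)%type.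
HB.instance Definition _ (S T : ptopologicalType) := Topological.on (S * T)%type.
HB.instance Definition _ (S T : puniformType) := Uniform.on (S * T)%type.
HB.instance Definition _ (R : numDomainType) (S T : pseudoPMetricType R) :=
  PseudoMetric.on (S * T)%type.

Section prod_complete.
Variables S T : completeType.

Lemma prod_cauchy_cvg (F : set_system (S * T)%type) :
  ProperFilter F -> cauchy F -> cvg F.
Proof.
move=> FF Fc.
have c1 : cauchy (fst @ F).
  move=> A entA; rewrite /= near_simpl -near2E near_map2; apply: Fc.
  exists (A, setT) => /=; first by split => //; exact: entourageT.
  by move=> [[a b] [c d]] [/= Aac _]; exists ((a, c), (b, d)).
have c2 : cauchy (snd @ F).
  move=> A entA; rewrite /= near_simpl -near2E near_map2; apply: Fc.
  exists (setT, A) => /=; first by split => //; exact: entourageT.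
  by move=> [[a b] [c d]] [/= _ Abd]; exists ((a, c), (b, d)).
apply/cvg_ex; exists (lim (fst @ F), lim (snd @ F)).
have pairE : (fun x : S * T => (x.1, x.2)) = id by apply/funext => -[].
have := @cvg_pair _ _ _ F _ _ _ _ _ fst snd (cauchy_cvg _ c1) (cauchy_cvg _ c2).
by rewrite pairE => h; exact: h.
Qed.

HB.instance Definition _ := Uniform_isComplete.Build (S * T)%type
  prod_cauchy_cvg.

End prod_complete.

HB.instance Definition _ (R : numDomainType) (S T : completePseudoMetricType R) :=
  Complete.on (S * T)%type.

(** * Borel measurability and Lipschitz functions *)

Lemma open_borel (T : ptopologicalType) (U : set T) :
  open U -> measurable (U : set (borel T)).
Proof. exact: sub_sigma_algebra. Qed.

Lemma continuous_borel_fun (S T : ptopologicalType) (f : S -> T) :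
  continuous f -> measurable_fun [set: borel S] (f : borel S -> borel T).
Proof.
move=> /continuousP cf.
apply: (@measurability _ _ _ (borel T) _ _ (@open T) erefl).
by move=> _ [U oU <-]; rewrite setTI; apply: open_borel; exact: cf.
Qed.

Lemma continuous_borel_measurable (R : realType) (T : ptopologicalType)
  (f : T -> R) : continuous f -> measurable_fun [set: borel T] f.
Proof.
move=> /continuousP cf; apply: (measurability _ (RGenOpens.measurableE R)).
move=> _ [_ [a [b ->] <-]]; rewrite setTI; apply: sub_sigma_algebra.
exact/cf/interval_open.
Qed.

Definition ball_lipschitz (R : realType) (T : pseudoMetricType R) (k : R)
    (f : T -> R) :=
  forall x y r, 0 < r -> ball x r y -> `|f x - f y| <= k * r.

Lemma lipschitz_fst (R : realType) (S T : pseudoMetricType R) k (f : S -> R) :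
  ball_lipschitz k f -> ball_lipschitz k (fun z : S * T => f z.1).
Proof. by move=> kf x y r r0 [xy _]; exact: kf. Qed.

Lemma lipschitz_snd (R : realType) (S T : pseudoMetricType R) k (f : T -> R) :
  ball_lipschitz k f -> ball_lipschitz k (fun z : S * T => f z.2).
Proof. by move=> kf x y r r0 [_ xy]; exact: kf. Qed.

Lemma ball_lipschitz_continuous (R : realType) (T : pseudoMetricType R) (k : R)
  (f : T -> R) : 0 <= k -> ball_lipschitz k f -> continuous f.
Proof.
move=> k0 kf x; apply/cvgrPdist_le => e e0.
have d0 : 0 < e / (k + 1) by rewrite divr_gt0// ltr_wpDl.
near=> y.
have h : ball x (e / (k + 1)) y by near: y; exact: nbhsx_ballx.
rewrite (le_trans (kf _ _ _ d0 h))// mulrCA ger_pMr// ler_pdivrMr ?ltr_wpDl//.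
by rewrite mul1r lerDl.
Unshelve. all: by end_near. Qed.

(** Membership of a limit in an open set, expressed by countably many conditions on
    the terms of the sequence; this makes a pointwise limit of measurable maps
    measurable. *)
Lemma cvg_open_ballP (R : realType) (T : pseudoMetricType R) (u : nat -> T) (z : T)
    (V : set T) : u @ \oo --> z -> open V ->
  V z <-> exists j M, forall m, (M <= m)%N -> ball (u m) (j.+1%:R^-1 : R) `<=` V.
Proof.
move=> uz oV; split => [Vz|[j [M jM]]].
  have /nbhs_ballP[e /= e0 eO] : nbhs z V by exact: open_nbhs_nbhs.
  have e20 : 0 < e / 2 by rewrite divr_gt0.
  near \oo => j; exists j.
  have [M _ zM] := cvg_ball uz e20.
  exists M => m Mm y uy; apply: eO; rewrite (splitr e).
  apply: ball_triangle (zM m Mm) _; apply: le_ball uy; apply: ltW.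
  near: j; apply: (near_infty_natSinv_lt (PosNum e20)).
have j0 : 0 < j.+1%:R^-1 :> R by rewrite invr_gt0.
have [N _ zN] := cvg_ball uz j0.
have := jM (maxn M N) (leq_maxl _ _); apply; apply: ball_sym.
by apply: zN => /=; exact: leq_maxr.
Unshelve. all: by end_near. Qed.

(** * Representing a tight mean by a Borel probability *)

Definition far (R : realType) (T : pseudoMetricType R) (s : seq T) (d : R) : set T :=
  [set z | forall c, c \in s -> ~ ball c d z].

(** Tightness, with totally bounded sets in the role of the compact ones: a mean
    gives almost all of its mass to finitely many balls, however small. *)
Definition tight (R : realType) (T : pseudoMetricType R) (L : (T -> R) -> R) :=
  forall e d : R, 0 < e -> 0 < d -> exists s : seq T, L \1_(far s d) <= e.

Section riesz.
Context (R : realType) (Z : completePseudoMetricType R).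
Variables (L : (Z -> R) -> R) (mL : is_mean L).

Let scale j : R := j.+1%:R^-1.

Lemma scale_gt0 j : 0 < scale j.
Proof. by rewrite invr_gt0. Qed.

(** The sets that split [Z] are the balls of all the nets of a double sequence:
    [net j i] consists of centres of balls of radius [1 / (j + 1)] that miss a
    part of [Z] of mass at most [1 / (i + 1)]. Almost every walk thus enters, for
    each [j], a ball of that radius and stays in it, so the representatives of
    its cells form a Cauchy sequence. The law of the limit is the measure sought. *)
Section net.
Variable net : nat -> nat -> seq Z.
Hypothesis netP : forall j i, L \1_(far (net j i) (scale j)) <= scale i.

Let test (m : nat) : set Z :=
  if (unpickle m : option (nat * nat * nat)) is Some (j, i, l) then
    [set z | (l < size (net j i))%N /\ ball (nth point (net j i) l) (scale j) z]
  else set0.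

Let idx j i l : nat := pickle ((j, i, l) : nat * nat * nat).

Let hits j m : set (seq bool) := [set s | exists i l,
  (idx j i l < m)%N /\ test (idx j i l) (rep test s)].

Let U : probability (measurableTypeR R) R := @uniform_prob R 0 1 ltr01.

Let approx t m : Z := rep test (branch test L t m).

Lemma misses_far j i : exists M, forall m, (M <= m)%N -> forall z,
  ~ hits j m (address test m z) -> far (net j i) (scale j) z.
Proof.
(* from this depth on, all the balls of [net j i] have been tested *)
exists (\max_(l < size (net j i)) idx j i l).+1 => m Mm z.
move=> nh c cs cz; apply: nh.
have lm : (index c (net j i) < size (net j i))%N by rewrite index_mem.
have km : (idx j i (index c (net j i)) < m)%N.
  apply: leq_trans Mm; rewrite ltnS.
  exact: (leq_bigmax (Ordinal lm)).
exists i, (index c (net j i)); split => //.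
rewrite (address_eq_test km (address_rep_address test m z)) /test /idx pickleK.
by split => //; rewrite nth_index.
Qed.

(** A hit is permanent: the later cells of the walk refine the one where it
    occurred. *)
Lemma hits_near t m j : 0 <= t < 1 -> hits j m (branch test L t m) ->
  exists c, forall m', (m <= m')%N -> ball c (scale j) (approx t m').
Proof.
move=> t01 [i [l [km hk]]]; exists (nth point (net j i) l) => m' mm'.
have : test (idx j i l) (approx t m').
  apply/(address_eq_test km _ (z' := rep test (branch test L t m))) => //.
  rewrite address_rep// (@address_branchW _ _ _ L t m')//.
  by rewrite address_rep.
by rewrite /test /idx pickleK => -[].
Qed.

Let good j : set (measurableTypeR R) :=
  \bigcup_m [set t | hits j m (branch test L t m)].

Lemma measurable_good j : measurable (good j).
Proof. by apply: bigcupT_measurable => m; exact: measurable_branch. Qed.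

(** The probability of no hit at scale [j] is at most the mass missed by
    [net j i], for each [i]. *)
Lemma good_full j : U (~` good j) = 0%E.
Proof.
apply/eqP; rewrite eq_le measure_ge0 andbT; apply/lee_addgt0Pr => e e0.
rewrite add0e.
near \oo => i.
have [M hM] := misses_far j i.
pose miss := [set t : measurableTypeR R | (~` hits j M) (branch test L t M)].
have mmiss : measurable miss by exact: measurable_branch.
apply: (@le_trans _ _ (U miss)).
  apply: le_measure; rewrite ?inE//.
    by apply: measurableC; exact: measurable_good.
  by move=> t /= gt h; apply: gt; exists M.
rewrite -[X in U X]setIT -integral_indic//.
rewrite [X in (X <= _)%E](_ : _ =
    (\int[U]_t (\1_(~` hits j M) (branch test L t M))%:E)%E); last first.
  by apply: eq_integral => t _; rewrite !indicE; congr (_%:R%:E).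
rewrite integral_branch//.
rewrite lee_fin; apply: (@le_trans _ _ (scale i)); last first.
  by apply: ltW; near: i; exact: (near_infty_natSinv_lt (PosNum e0)).
apply: le_trans (netP j i); apply: mean_le => //.
- by apply: bdd_01 => z; rewrite indicE; case: (_ \in _); rewrite lexx ler01.
- exact: bdd_indic.
- move=> z; rewrite !indicE ler_nat.
  case: (boolP (address _ _ _ \in _)) => //; rewrite inE => /(hM M (leqnn _)) fz.
  by rewrite mem_set.
Unshelve. all: by end_near. Qed.

Let D : set (measurableTypeR R) := `[0, 1[%classic `&` \bigcap_j good j.

Lemma measurable_D : measurable D.
Proof.
apply: measurableI => //; apply: bigcapT_measurable => j.
exact: measurable_good.
Qed.

Lemma negligible_DC : U.-negligible (~` D).
Proof.
rewrite setCI setC_bigcap; apply: negligibleU; last first.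
  apply: negligible_bigcup => j; apply/negligibleP; last exact: good_full.
  by apply: measurableC; exact: measurable_good.
apply/negligibleP; first exact: measurableC.
transitivity (1 - U `[0%R, 1%R[%classic)%E; first exact: probability_setC.
by rewrite uniform01 subee.
Qed.

Lemma approx_cvg t : D t -> cvg (approx t @ \oo).
Proof.
move=> [/= t01 tG]; apply: cauchy_cvg; apply: cauchy_exP => e e0.
near \oo => j.
have [m _ hm] := tG j I.
have [|c hc] := hits_near _ hm; first by move: t01; rewrite in_itv.
exists c; exists m => //= m' /hc; apply: le_ball; apply: ltW.
by near: j; exact: (near_infty_natSinv_lt (PosNum e0)).
Unshelve. all: by end_near. Qed.

Let limit (t : measurableTypeR R) : borel Z :=
  if t \in D then lim (approx t @ \oo) else point.

Lemma cvg_limit t : D t -> approx t @ \oo --> (limit t : Z).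
Proof. by move=> Dt; rewrite /limit mem_set//; exact: approx_cvg. Qed.

Lemma measurable_limit : measurable_fun setT limit.
Proof.
apply: (@measurability _ _ _ (borel Z) _ _ (@open Z) erefl).
move=> _ [V oV <-]; rewrite setTI.
pose ev : set (measurableTypeR R) :=
  \bigcup_j \bigcup_M \bigcap_(m in [set m | (M <= m)%N])
  [set t | [set s | ball (rep test s) (scale j) `<=` V] (branch test L t m)].
have mev : measurable ev.
  apply: bigcupT_measurable => j; apply: bigcupT_measurable => M.
  by apply: bigcap_measurable => [|m _]; [exists M => /=|exact: measurable_branch].
rewrite (_ : limit @^-1` V =
  (D `&` ev) `|` (~` D `&` [set t | V point])); last first.
  have evP t : D t -> V (limit t) <-> ev t.
    move=> Dt; rewrite (cvg_open_ballP (cvg_limit Dt) oV); split.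
      by move=> [j [M jM]]; exists j => //; exists M => // m /= /jM.
    by move=> [j _ [M _ jM]]; exists j, M => m /jM.
  apply/seteqP; split => t /=.
    move=> Vt; have [Dt|Dt] := pselect (D t).
      by left; split => //; apply/evP.
    by right; split => //; move: Vt; rewrite /limit memNset.
  move=> [[Dt /evP]|[Dt]]; first exact.
  by rewrite /limit memNset.
apply: measurableU.
  by apply: measurableI => //; exact: measurable_D.
apply: measurableI; first by apply: measurableC; exact: measurable_D.
have [Vp|Vp] := pselect (V point).
  by rewrite (_ : [set _ | _] = setT)//; apply/seteqP; split.
by rewrite (_ : [set _ | _] = set0)//; apply/seteqP; split.
Qed.

(** Replacing a point by the representative of its cell changes [f] little once a
    ball of radius [scale j] contains both, and by at most 1 elsewhere, on a set
    far from [net j i] and hence of small mass. *)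
Lemma riemann_mean k (f : Z -> R) : 0 <= k -> ball_lipschitz k f ->
  (forall z, 0 <= f z <= 1) ->
  L (fun z => f (rep test (address test m z))) @[m --> \oo] --> L f.
Proof.
move=> k0 kf f01; apply/cvgrPdist_le => e e0.
have bf := bdd_01 f01.
near \oo => j.
near \oo => i.
have [M hM] := misses_far j i.
exists M => // m /= Mm.
pose fm z := f (rep test (address test m z)).
have bfm : bdd fm by apply: bdd_01 => z; exact: f01.
pose g z := k * (2 * scale j) + \1_(far (net j i) (scale j)) z.
have bg : bdd g by apply: bddD; [exact: bdd_cst|exact: bdd_indic].
have fg z : `|f z - fm z| <= g z.
  rewrite /g.
  have [hz|/(hM _ Mm) hz] := pselect (hits j m (address test m z)).
    rewrite (@le_trans _ _ (k * (2 * scale j)))//; last first.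
      by rewrite lerDl indicE.
    apply: kf; first by rewrite mulr_gt0// scale_gt0.
    have [i' [l [km]]] := hz.
    move=> /[dup] h; rewrite (address_eq_test km (address_rep_address test m z)).
    move: h; rewrite /test /idx pickleK => -[_ h1] [_ h2].
    rewrite mulr_natl mulr2n; apply: ball_triangle h1; exact: ball_sym.
  rewrite indicE mem_set//= (@le_trans _ _ 1)//; last first.
    by rewrite lerDr !mulr_ge0// ltW// scale_gt0.
  have := f01 z; have := f01 (rep test (address test m z)); rewrite -/(fm z).
  by rewrite ler_norml; move=> /andP[? ?] /andP[? ?]; apply/andP; split; lra.
have Lg : L g <= e.
  rewrite (meanD mL); [|exact: bdd_cst|exact: bdd_indic].
  rewrite (mean_cst _ mL) (splitr e) lerD//.
    have : scale j <= e / 2 / (2 * (k + 1)).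
      near: j; have e' : 0 < e / 2 / (2 * (k + 1)).
        by rewrite !divr_gt0// mulr_gt0// ltr_wpDl.
      by apply: filterS (near_infty_natSinv_lt (PosNum e')) => n /ltW.
    rewrite ler_pdivlMr ?mulr_gt0 ?ltr_wpDl//.
    by have := scale_gt0 j; lra.
  apply: le_trans (netP j i) _.
  near: i; have e' : 0 < e / 2 by rewrite divr_gt0.
  by apply: filterS (near_infty_natSinv_lt (PosNum e')) => n /ltW.
rewrite ler_norml; apply/andP; split.
- suff : L fm <= L f + L g by rewrite -/fm; lra.
  rewrite -meanD//; apply: mean_le => //; first exact: bddD.
  by move=> z; have := fg z; rewrite ler_norml => /andP[]; lra.
- suff : L f <= L fm + L g by rewrite -/fm; lra.
  rewrite -meanD//; apply: mean_le => //; first exact: bddD.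
  by move=> z; have := fg z; rewrite ler_norml => /andP[]; lra.
Unshelve. all: by end_near. Qed.

Lemma integral_limit k (f : Z -> R) : 0 <= k -> ball_lipschitz k f ->
  (forall z, 0 <= f z <= 1) -> (\int[U]_t (f (limit t))%:E)%E = (L f)%:E.
Proof.
move=> k0 kf f01.
have f0 z : 0 <= f z by have /andP[] := f01 z.
have cf := ball_lipschitz_continuous k0 kf.
pose h m t : \bar R := (f (approx t m))%:E.
have [_ _ hcvg] : [/\ U.-integrable setT (fun t => (f (limit t))%:E),
    [sequence \int[U]_t (`|h n t - (f (limit t))%:E|)%E]_n @ \oo --> 0%E &
    [sequence \int[U]_t h n t]_n @ \oo --> \int[U]_t (f (limit t))%:E]%E.
  apply: (@dominated_convergence _ _ _ _ _ _ _ _ (cst 1%E)) => //.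
  - move=> m; apply/measurable_EFinP.
    move=> _ Y mY; rewrite setTI.
    exact: (@measurable_branch R _ test L [set s | Y (f (rep test s))] m).
  - apply/measurable_EFinP; apply: measurableT_comp measurable_limit.
    exact: continuous_borel_measurable.
  - apply: negligibleS negligible_DC => t /= nt Dt; apply: nt => _.
    apply: cvg_EFin; first by apply: nearW.
    exact: (cvg_comp _ _ (cvg_limit Dt) (cf (limit t))).
  - exact: (finite_measure_integrable_cst U 1).
  - apply: aeW => t m _; rewrite /h lee_fin.
    by have /andP[? ?] := f01 (approx t m); rewrite ger0_norm.
apply: (cvg_unique _ hcvg) => //.
rewrite (_ : [sequence _]_n =
  fun m => (L (fun z => f (rep test (address test m z))))%:E).
  apply: cvg_EFin; first by apply: nearW.
  exact: riemann_mean k0 kf f01.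
apply/funext => m /=; rewrite /h.
by apply: (@integral_branch R _ test L mL (f \o rep test) m) => s; exact: f0.
Qed.

Lemma net_riesz : exists P : probability (borel Z) R,
  forall k f, 0 <= k -> ball_lipschitz k f -> (forall z, 0 <= f z <= 1) ->
  (\int[P]_z (f z)%:E)%E = (L f)%:E.
Proof.
pose limit_mixin := isMeasurableFun.Build _ _ _ _ _ measurable_limit.
pose X : {mfun _ >-> _} := HB.pack limit limit_mixin.
exists (distribution U X) => k f k0 kf f01.
rewrite ge0_integral_distribution; first exact: integral_limit kf f01.
  apply/measurable_EFinP; apply: continuous_borel_measurable.
  exact: ball_lipschitz_continuous kf.
by move=> z; rewrite lee_fin; have /andP[] := f01 z.
Qed.

End net.

(** A Riesz representation theorem: tightness and completeness replace local
    compactness. Lipschitz functions are those that vary uniformly little on the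
    small cells, and they suffice to determine a Borel probability. *)
Theorem tight_mean_riesz : tight L -> exists P : probability (borel Z) R,
  forall k f, 0 <= k -> ball_lipschitz k f -> (forall z, 0 <= f z <= 1) ->
  (\int[P]_z (f z)%:E)%E = (L f)%:E.
Proof.
move=> tL.
have /choice[net netP] : forall ji : nat * nat, exists s : seq Z,
    L \1_(far s (scale ji.1)) <= scale ji.2.
  by move=> [j i]; exact: tL (scale_gt0 i) (scale_gt0 j).
exact: (@net_riesz (fun j i => net (j, i)) (fun j i => netP (j, i))).
Qed.

End riesz.

(** * Integrals of bounded functions *)

Lemma bounded_fun_bdd (R : realType) (S : Type) (f : S -> R) :
  bounded_fun f -> bdd f.
Proof.
move=> [M [Mr hM]]; exists (M + 1) => z.
by apply: (hM (M + 1)) => //; rewrite ltrDl.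
Qed.

Section bounded_integrals.
Context (R : realType) d (T : measurableType d) (P : probability T R).
Implicit Types f g : T -> R.

Lemma bdd_integrable f : measurable_fun setT f -> bdd f ->
  P.-integrable setT (EFin \o f).
Proof.
move=> mf [M fM]; apply: measurable_bounded_integrable => //.
  exact: le_lt_trans (probability_le1 P measurableT) (ltry _).
exists M; split; first exact: num_real.
by move=> N MN x _; exact: le_trans (fM x) (ltW MN).
Qed.

Lemma fine_probability (D : set T) : measurable D -> (fine (P D))%:E = P D.
Proof. by move=> mD; rewrite fineK// fin_num_measure. Qed.

Lemma EFin_Rintegral f : measurable_fun setT f -> bdd f ->
  (\int[P]_x (f x)%:E)%E = (\int[P]_x f x)%:E.
Proof.
move=> mf bf; rewrite /Rintegral fineK//.
by have /integrable_fin_num := bdd_integrable mf bf; exact.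
Qed.

Lemma Rintegral_prob_cst c : \int[P]_x (cst c x) = c.
Proof.
rewrite Rintegral_cst// -[RHS]mulr1; congr (_ * _).
rewrite -[RHS]/(fine 1%E); congr fine.
exact: probability_setT.
Qed.

Lemma Rintegral_indic (A : set T) : measurable A ->
  \int[P]_x (\1_A x) = fine (P A).
Proof. by move=> mA; rewrite /Rintegral integral_indic// setIT. Qed.

Lemma measurable_lincomb (I : Type) (s : seq I) (c : I -> R) (F : I -> T -> R) :
  (forall i, measurable_fun setT (F i)) ->
  measurable_fun setT (fun x => \sum_(i <- s) c i * F i x).
Proof.
move=> mF; apply: measurable_sum => i.
by apply: measurable_funM => //; exact: measurable_cst.
Qed.

Lemma Rintegral_lincomb (I : Type) (s : seq I) (c : I -> R) (F : I -> T -> R) :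
  (forall i, measurable_fun setT (F i)) -> (forall i, bdd (F i)) ->
  \int[P]_x (\sum_(i <- s) c i * F i x) = \sum_(i <- s) c i * \int[P]_x F i x.
Proof.
move=> mF bF; elim: s => [|i s ih].
  rewrite big_nil; under eq_Rintegral do rewrite big_nil.
  exact: Rintegral_prob_cst.
under eq_Rintegral do rewrite big_cons.
rewrite big_cons RintegralD//.
- by rewrite ih RintegralZl//; exact: bdd_integrable.
- apply: bdd_integrable; last exact: bddZ.
  by apply: measurable_funM => //; exact: measurable_cst.
- apply: bdd_integrable; first exact: measurable_lincomb.
  by apply: bdd_sum => j; exact: bddZ.
Qed.

End bounded_integrals.

(** * Supports *)

Section support.
Context (R : realType) (T : ptopologicalType).
Hypothesis scT : @second_countable T.

Lemma second_countable_seq : exists B : nat -> set T,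
  (forall n, open (B n)) /\
  forall x U, open_nbhs x U -> exists2 n, B n x & B n `<=` U.
Proof.
have [B /countable_injP[f finj] [oB nB]] := scT.
pose C n := if pselect (exists2 V, B V & f V = n) is left e then
  sval (cid2 e) else set0.
exists C; split.
  move=> n; rewrite /C; case: pselect => [e|_]; last exact: open0.
  by case: cid2 => /= V BV _; exact: oB.
move=> x U xU.
have [V /= [BV Vx] VU] : filter_from [set U | B U /\ U x] id U.
  exact/nB/open_nbhs_nbhs.
exists (f V).
  rewrite /C; case: pselect => [e|]; last by case; exists V.
  by case: cid2 => /= V' BV' /finj; rewrite !inE => ->.
rewrite /C; case: pselect => [e|]; last by case; exists V.
by case: cid2 => /= V' BV' /finj; rewrite !inE => ->.
Qed.

Variable P : probability (borel T) R.

(** The complement of the support is the union of the null open sets; second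
    countability makes this a countable union. *)
Lemma supp_null : measurable (~` supp P : set (borel T)) /\ P (~` supp P) = 0%E.
Proof.
have [B [oB nB]] := second_countable_seq.
pose N n : set (borel T) := if P (B n) == 0%E then B n else set0.
have mN n : measurable (N n).
  by rewrite /N; case: ifP => // _; exact: open_borel.
have -> : ~` supp P = \bigcup_n N n.
  apply/seteqP; split => x /=.
    move=> /existsNP[U /not_implyP[xU /negP]]; rewrite -leNgt => PU0.
    have [n Bnx BnU] := nB x U xU; exists n => //; rewrite /N ifT//.
    rewrite eq_le measure_ge0 andbT (le_trans _ PU0)//.
    apply: le_measure; rewrite ?inE//; first exact: open_borel.
    by apply: open_borel; case: xU.
  move=> [n _]; rewrite /N; case: ifP => // /eqP PB0 Bx /(_ (B n)).
  by rewrite PB0 ltxx => h; suff: false by []; apply: h; split.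
split; first exact: bigcupT_measurable.
apply/negligibleP; first exact: bigcupT_measurable.
apply: negligible_bigcup => n; apply/negligibleP; first exact: mN.
by rewrite /N; case: ifP => [/eqP//|_]; exact: measure0.
Qed.

(** A function cannot exceed its mean on the whole support, a set of full
    measure. *)
Lemma exists_supp_le_integral (h : T -> R) :
  measurable_fun [set: borel T] h -> bdd h ->
  exists2 z, supp P z & h z <= \int[P]_x h x.
Proof.
move=> mh bh; apply: contrapT => nh.
have [mN N0] := supp_null.
set m := \int[P]_x h x in nh.
(* otherwise [h - m] is positive on the support but has integral zero *)
have pos z : supp P z -> 0 < h z - m.
  move=> sz; rewrite subr_gt0 ltNge; apply/negP => hm; apply: nh.
  by exists z.
have mg : measurable_fun [set: borel T] (fun z => h z - m).
  by apply: measurable_funB => //; exact: measurable_cst.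
have ig : P.-integrable [set: borel T] (EFin \o (fun z => h z - m)).
  by apply: bdd_integrable => //; apply: bddD => //; exact: bdd_cst.
have int0 : (\int[P]_(z in [set: borel T]) (h z - m)%:E = 0)%E.
  rewrite EFin_Rintegral//; last by apply: bddD => //; exact: bdd_cst.
  rewrite RintegralB//; [|exact: bdd_integrable|].
    by rewrite (Rintegral_prob_cst P m) -/m subrr.
  by apply: bdd_integrable; [exact: measurable_cst|exact: bdd_cst].
have mS : measurable (supp P : set (borel T)).
  by rewrite -[supp P]setCK; exact: measurableC.
have : (\int[P]_(z in (supp P : set (borel T))) `|(h z - m)%:E| = 0)%E.
  rewrite -int0 [RHS](negligible_integral mN)// setTD setCK.
  apply: eq_integral => z; rewrite inE => /pos z0.
  by rewrite gee0_abs// lee_fin ltW.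
move=> /ae_eq_integral_abs -/(_ mS) h0.
have /(negligibleP _ mS) PS : P.-negligible (supp P : set (borel T)).
  apply: negligibleS (h0 _) => /=.
    move=> z sz /(_ sz) /eqP; rewrite eqe => /eqP e.
    by have := pos z sz; rewrite e ltxx.
  by apply/measurable_EFinP; exact: measurable_funTS.
have : P (~` supp P : set (borel T)) = (1 - P (supp P))%E.
  exact: probability_setC.
rewrite N0; move: PS => /= ->; rewrite sube0 => /eqP.
by rewrite eqe eq_sym oner_eq0.
Qed.

End support.

(** * Empirical averages and weak convergence *)

Definition average (R : realType) (T : Type) (x : nat -> T) n (f : T -> R) : R :=
  n%:R^-1 * \sum_(i < n) f (x i).

Section average_theory.
Context (R : realType) (T : Type) (x : nat -> T).

Lemma average_is_mean n : (0 < n)%N -> is_mean (@average R T x n).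
Proof.
move=> n0; split.
- by move=> f g _ _; rewrite /average big_split mulrDr.
- by move=> c f _; rewrite /average -mulr_sumr mulrCA.
- move=> f g _ _ fg; rewrite /average ler_wpM2l ?invr_ge0//.
  by apply: ler_sum => i _.
- by rewrite /average sumr_const card_ord mulVf// pnatr_eq0 -lt0n.
Qed.

Lemma average_le n (f g : T -> R) : (forall z, f z <= g z) ->
  average x n f <= average x n g.
Proof. by move=> fg; rewrite ler_wpM2l ?invr_ge0//; apply: ler_sum. Qed.

End average_theory.

Section empirical_integral.
Context (R : realType) (T : ptopologicalType) (x : nat -> T) (n : nat).

Lemma integral_empirical (f : T -> R) : measurable_fun [set: borel T] f ->
  (\int[@empirical R T x n]_(z in [set: borel T]) (f z)%:E)%E =
  (average x n f)%:E.
Proof.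
move=> mf.
have ge0E (g : T -> R) : measurable_fun [set: borel T] g -> (forall z, 0 <= g z) ->
    (\int[@empirical R T x n]_(z in [set: borel T]) (g z)%:E)%E =
    (average x n g)%:E.
  move=> mg g0.
  have mg' : measurable_fun [set: borel T] (EFin \o g) by exact/measurable_EFinP.
  have g0' z : [set: borel T] z -> (0 <= (g z)%:E)%E by rewrite lee_fin.
  rewrite ge0_integral_mscale// ge0_integral_measure_sum//.
  rewrite /average EFinM -sumEFin; congr (_ * _)%E; apply: eq_bigr => i _.
  rewrite integral_dirac//.
  by rewrite diracT mul1e.
rewrite integralE funerpos funerneg.
rewrite !ge0E; [|exact: measurable_funrneg|by []|exact: measurable_funrpos|by []].
rewrite -EFinB -mulrBr -sumrB; congr (_ * _)%:E; apply: eq_bigr => i _.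
by rewrite -[in RHS](funrposBneg f).
Qed.

End empirical_integral.

(** The number of thresholds [0, 1, ..., N - 1] below [u] is [u] up to an error of
    one; this is the layer-cake approximation of [u] by indicators. *)
Lemma count_below (R : realType) (u : R) (N : nat) : 0 <= u <= N%:R ->
  u <= \sum_(j < N) ((j%:R < u)%R : nat)%:R <= u + 1.
Proof.
move=> /andP[u0 uN]; apply/andP; split.
  elim: N uN => [|N ih] uN; first by rewrite big_ord0.
  rewrite big_ord_recr/=; have [Nu|uN'] := ltP N%:R u; last first.
    by rewrite addr0; exact: ih.
  rewrite (eq_bigr (fun=> 1)); first by rewrite sumr_const card_ord natr1.
  by move=> j _; rewrite (lt_trans _ Nu)// ltr_nat.
elim: N {uN} => [|N ih]; first by rewrite big_ord0; lra.
rewrite big_ord_recr/=; have [Nu|uN'] := ltP N%:R u; last by rewrite addr0.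
rewrite lerD2r; apply: le_trans (ltW Nu).
rewrite -[leRHS]mulr1 -[X in _ * X]/(1%:R) mulr_natl.
rewrite -[X in _ *+ X](card_ord N) -sumr_const.
by apply: ler_sum => j _; rewrite ler_nat leq_b1.
Qed.

(** Portmanteau: a lower bound on the asymptotic frequency of every open set
    implies weak convergence. A continuous [f] with values in [0, 1] is within
    [1 / N] of the average of the indicators of the [N] open sets
    [j / N < f], which bounds its averages from below; applying this to an affine
    image of [f] and of [- f] gives the limit. *)
Section portmanteau.
Context (R : realType) (T : ptopologicalType) (P : probability (borel T) R).
Variable x : nat -> T.
Hypothesis liminf_open : forall (U : set T) (e : R), open U -> 0 < e ->
  \forall n \near \oo, fine (P U) - e <= average x n \1_U.

Lemma liminf_unit_continuous (f : T -> R) (e : R) : continuous f ->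
  (forall z, 0 <= f z <= 1) -> 0 < e ->
  \forall n \near \oo, \int[P]_z f z - e <= average x n f.
Proof.
move=> cf f01 e0.
near \oo => N.
have N0 : 0 < N%:R :> R by rewrite ltr0n; near: N; exists 1%N.
have Ne : N%:R^-1 <= e / 2.
  rewrite invf_ple ?posrE ?divr_gt0//.
  by near: N; apply: nbhs_infty_ger.
pose U (j : 'I_N) : set T := [set z | j%:R < N%:R * f z].
have oU j : open (U j).
  rewrite (_ : U j = (fun z => N%:R * f z) @^-1` [set y | j%:R < y])//.
  apply: open_comp; last exact: open_gt.
  by move=> z _; apply: cvgMr; exact: cf.
pose g z : R := \sum_j N%:R^-1 * \1_(U j) z.
have gE z : g z = N%:R^-1 * \sum_(j < N) ((j%:R < N%:R * f z)%R : nat)%:R.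
  rewrite /g -mulr_sumr; congr (_ * _); apply: eq_bigr => j _.
  rewrite indicE; congr (_%:R); congr nat_of_bool.
  by apply/idP/idP; rewrite inE.
have fg z : f z <= g z <= f z + N%:R^-1.
  have /count_below /andP[h1 h2] : 0 <= N%:R * f z <= N%:R.
    have /andP[f0 f1] := f01 z.
    by rewrite (mulr_ge0 (ltW N0) f0)/= ger_pMr.
  rewrite gE ler_pdivlMl// h1/= ler_pdivrMl// mulrDr mulfV//.
  by rewrite gt_eqF.
have mU j : measurable_fun [set: borel T] (\1_(U j) : T -> R).
  by apply: measurable_indic; exact: open_borel.
have bU j : bdd (\1_(U j) : T -> R) by exact: bdd_indic.
have intfg : \int[P]_z f z <= \int[P]_z g z.
  apply: le_Rintegral => //; last by move=> z _; have /andP[] := fg z.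
    apply: bdd_integrable; last exact: bdd_01.
    exact: continuous_borel_measurable.
  apply: bdd_integrable; first exact: measurable_lincomb.
  by apply: bdd_sum => j; exact: bddZ.
rewrite Rintegral_lincomb// in intfg.
have near_all : \forall n \near \oo, forall j : 'I_N,
    fine (P (U j)) - e / 2 <= average x n \1_(U j).
  apply: filter_forall => j.
  by apply: liminf_open => //; rewrite divr_gt0.
near=> n.
have hn : forall j : 'I_N, fine (P (U j)) - e / 2 <= average x n \1_(U j).
  by near: n.
have n0 : (0 < n)%N by near: n; exists 1%N.
have avg_g : average x n g <= average x n f + N%:R^-1.
  have mA := @average_is_mean R _ x _ n0.
  rewrite -[X in _ + X](mean_cst _ mA) -(meanD mA); last 2 first.
  - exact: bdd_01.
  - exact: bdd_cst.
  by apply: average_le => z; have /andP[] := fg z.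
have : \sum_(j < N) N%:R^-1 * (fine (P (U j)) - e / 2) <= average x n g.
  have mA := @average_is_mean R _ x _ n0.
  rewrite mean_sum//; last by move=> j; exact: bddZ.
  by apply: ler_sum => j _; rewrite (meanZ mA)// ler_wpM2l// invr_ge0 ltW.
under eq_bigr do rewrite mulrBr.
have sumc : \sum_(j < N) N%:R^-1 * (e / 2) = e / 2.
  by rewrite sumr_const card_ord -[LHS]mulr_natl mulrA mulfV ?mul1r// gt_eqF.
rewrite sumrB sumc.
have IE : \sum_j N%:R^-1 * \int[P]_z \1_(U j) z =
    \sum_j N%:R^-1 * fine (P (U j)).
  by apply: eq_bigr => j _; rewrite Rintegral_indic//; exact: open_borel.
by rewrite IE in intfg; lra.
Unshelve. all: by end_near. Qed.

Lemma liminf_open_weak_cvg : weak_cvg (@empirical R T x) P.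
Proof.
move=> f cf /bounded_fun_bdd [M fM].
have bf : bdd f by exists M.
have mf : measurable_fun [set: borel T] f by exact: continuous_borel_measurable.
under eq_fun do rewrite integral_empirical//.
rewrite EFin_Rintegral//; apply: cvg_EFin; first by apply: nearW.
apply/cvgrPdist_le => e e0 /=.
have M0 : 0 < M + 1.
  by rewrite ltr_wpDl// (le_trans _ (fM point)).
pose c := (2 * (M + 1))^-1.
have c0 : 0 < c by rewrite invr_gt0 mulr_gt0.
(* [g 1] and [g (-1)] are affine images of [f] and [- f] with values in [0, 1] *)
pose g (s : R) z := 2^-1 + s * (c * f z).
have g01 s z : `|s| = 1 -> 0 <= g s z <= 1.
  move=> s1; have : `|s * (c * f z)| <= 2^-1.
    rewrite !normrM s1 mul1r gtr0_norm// /c invfM -mulrA ler_pdivrMl//.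
    rewrite mulfV// ler_pdivrMl// mulr1 (le_trans (fM z))//.
    by rewrite lerDl.
  by rewrite ler_norml => /andP[]; rewrite /g; lra.
have cg s : continuous (g s).
  move=> z; apply: cvgD; first exact: cvg_cst.
  by apply: cvgMr; apply: cvgMr; exact: cf.
have Ig s : \int[P]_z g s z = 2^-1 + s * (c * \int[P]_z f z).
  rewrite RintegralD//.
  - rewrite (Rintegral_prob_cst P 2^-1) RintegralZl ?RintegralZl//.
      exact: bdd_integrable.
    apply: bdd_integrable; last exact: bddZ.
    by apply: measurable_funM => //; exact: measurable_cst.
  - by apply: bdd_integrable; [exact: measurable_cst|exact: bdd_cst].
  - apply: bdd_integrable; last by do 2 apply: bddZ.
    by do 2 (apply: measurable_funM; first exact: measurable_cst).
have ce0 : 0 < c * e by rewrite mulr_gt0.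
have lower s : `|s| = 1 -> \forall n \near \oo,
    s * (\int[P]_z f z) - e <= s * average x n f.
  move=> s1; near=> n.
  have n0 : (0 < n)%N by near: n; exists 1%N.
  have mA := @average_is_mean R _ x _ n0.
  have : \int[P]_z g s z - c * e <= average x n (g s).
    near: n; apply: (liminf_unit_continuous (cg s)) => // z; exact: g01.
  rewrite Ig (meanD mA); last 2 first.
  - exact: bdd_cst.
  - by do 2 apply: bddZ.
  rewrite (mean_cst _ mA) (meanZ mA); last exact: bddZ.
  rewrite (meanZ mA)// -addrA lerD2l => h.
  by rewrite -(ler_pM2l c0) mulrBr !(mulrCA c s).
have l1 := lower 1 (normr1 _); have l2 := lower (-1) (normrN1 _).
near=> n.
have : 1 * (\int[P]_z f z) - e <= 1 * average x n f by near: n.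
have : -1 * (\int[P]_z f z) - e <= -1 * average x n f by near: n.
by rewrite ler_norml => ? ?; apply/andP; split; lra.
Unshelve. all: by end_near. Qed.

End portmanteau.

(** * Uniformly distributed sequences in the support *)

(** Herding: a deterministic substitute for the strong law of large numbers. For
    countably many events [A k], [drift s k] is the excess of hits of [A k] by the
    sample [s] over their expected number. The next point [z] is chosen in the
    support of [P] so that the weighted sum of the [drift s k * dev k z] is
    nonpositive; such a point exists because this sum has mean zero. The weighted
    sum of squares of the drifts then grows at most linearly, so each drift is
    O(sqrt n) and each frequency converges. *)
Section herding.
Context (R : realType) (T : ptopologicalType).
Hypothesis scT : @second_countable T.
Variable P : probability (borel T) R.
Variable A : nat -> set T.
Hypothesis mA : forall k, measurable (A k : set (borel T)).

Let dev k z : R := \1_(A k) z - fine (P (A k)).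
(* any positive weights with bounded sums and [weight n * n ^+ 2] bounded fit *)
Let weight k : R := (4 ^+ k)^-1.
Let drift (s : seq T) k : R := \sum_(z <- s) dev k z.
Let pick (s : seq T) : T := xget point [set z | supp P z /\
  \sum_(k < (size s).+1) weight k * drift s k * dev k z <= 0].

Fixpoint history n : seq T :=
  if n is n'.+1 then pick (history n') :: history n' else [::].

Let energy n := \sum_(k < n) weight k * drift (history n) k ^+ 2.

Lemma size_history n : size (history n) = n.
Proof. by elim: n => //= n ->. Qed.

Lemma dev_le1 k z : `|dev k z| <= 1.
Proof.
have p0 : 0 <= fine (P (A k)) by rewrite fine_ge0.
have p1 : fine (P (A k)) <= 1.
  by rewrite -lee_fin fine_probability//; exact: probability_le1.
rewrite /dev indicE ler_norml; case: (_ \in _) => /=; apply/andP; split; lra.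
Qed.

Lemma weight_gt0 k : 0 < weight k.
Proof. by rewrite invr_gt0 exprn_gt0. Qed.

Lemma pickP s : supp P (pick s) /\
  \sum_(k < (size s).+1) weight k * drift s k * dev k (pick s) <= 0.
Proof.
rewrite /pick; case: xgetP => [z _ //|none]; exfalso.
pose h z := \sum_(k < (size s).+1) weight k * drift s k * \1_(A k) z.
have mI (k : 'I_(size s).+1) : measurable_fun [set: borel T] (\1_(A k) : T -> R).
  exact: measurable_indic.
have bI (k : 'I_(size s).+1) : bdd (\1_(A k) : T -> R) by exact: bdd_indic.
have [||z sz] := @exists_supp_le_integral R T scT P h.
- exact: measurable_lincomb.
- by apply: bdd_sum => k; exact: bddZ.
rewrite Rintegral_lincomb// => hz; apply: (none z); split => //.
rewrite -subr_le0 -sumrB in hz; apply: le_trans hz; rewrite le_eqVlt.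
apply/orP; left; apply/eqP; apply: eq_bigr => k _.
by rewrite -mulrBr Rintegral_indic.
Qed.

Lemma drift_le n k : `|drift (history n) k| <= n%:R.
Proof.
rewrite -{2}(size_history n); elim: (history n) => [|z s ih].
  by rewrite /drift big_nil normr0.
rewrite /drift big_cons (le_trans (ler_normD _ _))//= -natr1 addrC lerD//.
exact: dev_le1.
Qed.

Lemma sum_weight n : \sum_(k < n) weight k <= 2 - 2 * weight n.
Proof.
elim: n => [|n ih]; first by rewrite big_ord0 /weight expr0 invr1; lra.
rewrite big_ord_recr /=; have := weight_gt0 n.
rewrite /weight exprS invfM -/(weight n); have : (4^-1 : R) = 1 / 4 by lra.
by move=> ->; lra.
Qed.

Lemma weight_square n : weight n * n%:R ^+ 2 <= 1.
Proof.
rewrite ler_pdivrMl ?exprn_gt0// mulr1 -natrX -natrX ler_nat.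
rewrite (_ : 4 = 2 ^ 2)%N// -expnM mulnC expnM leq_exp2r//.
by rewrite ltnW// ltn_expl.
Qed.

(** The step from [n] to [n + 1] adds three terms to the energy: the square of the
    old drift for the new event [A n], at most 1 thanks to its small weight; the
    cross terms, nonpositive by the choice of the point; and the weighted squares
    of the deviations, at most the total weight 2. *)
Lemma energy_le n : energy n <= 3 * n%:R.
Proof.
elim: n => [|n ih]; first by rewrite /energy big_ord0 mulr0.
rewrite /energy /=.
have [_] := pickP (history n); rewrite size_history; set z := pick _ => hz.
have -> : \sum_(k < n.+1) weight k * drift (z :: history n) k ^+ 2 =
    \sum_(k < n.+1) weight k * drift (history n) k ^+ 2 +
    2 * (\sum_(k < n.+1) weight k * drift (history n) k * dev k z) +
    \sum_(k < n.+1) weight k * dev k z ^+ 2.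
  rewrite mulr_sumr -!big_split/=; apply: eq_bigr => k _.
  by rewrite /drift big_cons -/(drift _ _); ring.
have h1 : \sum_(k < n.+1) weight k * dev k z ^+ 2 <= 2.
  apply: le_trans (_ : \sum_(k < n.+1) weight k <= 2); last first.
    by have := sum_weight n.+1; have := weight_gt0 n.+1; lra.
  apply: ler_sum => k _; rewrite ger_pMr ?weight_gt0//.
  by rewrite -[_ ^+ 2]ger0_norm ?sqr_ge0// normrX expr_le1//; exact: dev_le1.
have h2 : \sum_(k < n.+1) weight k * drift (history n) k ^+ 2 <= energy n + 1.
  rewrite big_ord_recr /= lerD2l (le_trans _ (weight_square n))//.
  rewrite ler_pM2l ?weight_gt0// -[leLHS]ger0_norm ?sqr_ge0// normrX.
  by rewrite lerXn2r ?nnegrE//; exact: drift_le.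
by rewrite -natr1; move: hz; lra.
Qed.

Definition herd n : T := pick (history n).

Lemma herd_supp n : supp P (herd n).
Proof. by have [] := pickP (history n). Qed.

Lemma history_sum (F : T -> R) n :
  \sum_(z <- history n) F z = \sum_(i < n) F (herd i).
Proof.
elim: n => [|n ih]; first by rewrite big_nil big_ord0.
by rewrite big_cons big_ord_recr/= ih addrC.
Qed.

Lemma herd_cvg k : average herd n \1_(A k) @[n --> \oo] --> fine (P (A k)).
Proof.
apply/cvgrPdist_le => e e0; near=> n.
have n0 : (0 < n)%N by near: n; exists 1%N.
have n0' : 0 < n%:R :> R by rewrite ltr0n.
have -> : fine (P (A k)) - average herd n \1_(A k) =
    - (drift (history n) k / n%:R).
  rewrite /drift history_sum sumrB sumr_const card_ord /average.
  rewrite -[fine _ *+ n]mulr_natl mulrBl [n%:R * _]mulrC mulfK ?gt_eqF//.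
  by rewrite opprB mulrC.
rewrite normrN normrM normfV [`|n%:R|]gtr0_norm// ler_pdivrMr//.
have en0 : 0 <= e * n%:R by apply: mulr_ge0; exact: ltW.
rewrite -ler_sqr ?nnegrE//.
rewrite -normrX ger0_norm ?sqr_ge0// -(ler_pM2l (weight_gt0 k)).
have kn : (k < n)%N by near: n; exists k.+1.
apply: le_trans (_ : energy n <= _).
  rewrite /energy (bigD1 (Ordinal kn))//= lerDl sumr_ge0// => i _.
  by rewrite mulr_ge0 ?sqr_ge0// ltW// weight_gt0.
apply: (le_trans (energy_le n)); rewrite exprMn [n%:R ^+ 2]expr2 !mulrA ler_pM2r//.
rewrite -ler_pdivrMl ?mulr_gt0 ?exprn_gt0 ?weight_gt0//.
by near: n; apply: nbhs_infty_ger.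
Unshelve. all: by end_near. Qed.

End herding.

(** Herding is applied to the finite unions of basic open sets: they exhaust each
    open set from inside, so the frequencies of the open sets are bounded from
    below as required by [liminf_open_weak_cvg]. *)
Theorem unif_seq_in_supp (R : realType) (T : ptopologicalType)
    (P : probability (borel T) R) : @second_countable T ->
  exists x : nat -> T, (forall n, supp P (x n)) /\ weak_cvg (@empirical R T x) P.
Proof.
move=> scT; have [B [oB nB]] := second_countable_seq scT.
(* all the finite unions of basic sets *)
pose A k : set T := if (unpickle k : option (seq nat)) is Some s then
  \bigcup_(i in [set` s]) B i else set0.
have oA k : open (A k).
  rewrite /A; case: unpickle => [s|]; last exact: open0.
  by apply: bigcup_open => i _; exact: oB.
have mA k : measurable (A k : set (borel T)) by exact: open_borel.
exists (herd P A); split; first exact: herd_supp.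
apply: liminf_open_weak_cvg => U e oU e0.
pose idx m : seq nat := [seq i <- iota 0 m | `[< B i `<=` U >]].
pose V m : set (borel T) := A (pickle (idx m)).
have VE m : V m = \bigcup_(i in [set` idx m]) B i.
  by rewrite /V /A pickleK.
have VU : \bigcup_m V m = U.
  apply/seteqP; split => z.
    move=> [m _]; rewrite VE => -[i /=]; rewrite mem_filter => /andP[/asboolP iU _].
    exact: iU.
  move=> Uz; have [i Biz BiU] := nB z U (conj oU Uz).
  exists i.+1 => //; rewrite VE; exists i => //=.
  by rewrite mem_filter mem_iota/= add0n ltnSn andbT; apply/asboolP.
have ndV : nondecreasing_seq V.
  move=> m n mn; apply/subsetPset => z; rewrite !VE => -[i /= im Biz].
  exists i => //=; move: im; rewrite !mem_filter !mem_iota !add0n/=.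
  by move=> /andP[-> /leq_trans]; apply.
have cvgV : P (V m) @[m --> \oo] --> P U.
  rewrite -[in P U]VU; apply: nondecreasing_cvg_mu => //.
  - by move=> m; exact: mA.
  - by rewrite VU; exact: open_borel.
have cvgfV : fine (P (V m)) @[m --> \oo] --> fine (P U).
  apply: fine_cvg; rewrite fineK ?fin_num_measure//; exact: open_borel.
have e20 : 0 < e / 2 by rewrite divr_gt0.
have /cvgrPdist_le /(_ _ e20) [m _ hm] := cvgfV.
have /cvgrPdist_le /(_ _ e20) := @herd_cvg R T scT P A mA (pickle (idx m)).
apply: filterS => n hn.
apply: le_trans (_ : average (herd P A) n \1_(V m) <= _).
  have := hm m (leqnn _); move: hn; rewrite -/(V m) !ler_norml.
  by move=> /andP[? ?] /andP[? ?]; lra.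
apply: average_le => z; rewrite !indicE ler_nat.
case: (boolP (z \in V m)) => //; rewrite inE => Vz.
by rewrite mem_set// -VU; exists m.
Qed.

(** * Borel probabilities are determined by Lipschitz functions *)

Section depth.
Context (R : realType) (T : pseudoMetricType R).
Implicit Types (U : set T) (x y : T).

Let radii U x : set R := [set r | r = 0 \/ 0 < r <= 1 /\ ball x r `<=` U].

(** The radius, capped at 1, of the largest ball around [x] inside [U]. It replaces
    the distance to the complement of [U], and makes sense in any pseudometric
    space. *)
Definition depth U x : R := sup (radii U x).

Lemma radii_has_sup U x : has_sup (radii U x).
Proof.
split; first by exists 0; left.
by exists 1 => r /= [-> //|[/andP[]]].
Qed.

Lemma depth_ge0 U x : 0 <= depth U x.
Proof. by apply: ub_le_sup; [have [] := radii_has_sup U x|left]. Qed.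

Lemma depth_le1 U x : depth U x <= 1.
Proof.
apply: ge_sup; first by have [] := radii_has_sup U x.
by move=> r /= [-> //|[/andP[]]].
Qed.

Lemma depth_gt0 U x : open U -> U x -> 0 < depth U x.
Proof.
move=> oU Ux; have /nbhs_ballP[e /= e0 eU] : nbhs x U by exact: open_nbhs_nbhs.
apply: (@lt_le_trans _ _ (Num.min 1 e)); first by rewrite lt_min ltr01.
apply: ub_le_sup; first by have [] := radii_has_sup U x.
right; rewrite lt_min ltr01 e0 ge_min lexx; split => //.
by apply: subset_trans eU; apply: le_ball; rewrite ge_min lexx orbT.
Qed.

Lemma depth_out U x : ~ U x -> depth U x = 0.
Proof.
move=> Ux; apply/eqP; rewrite eq_le depth_ge0 andbT.
apply: ge_sup; first by have [] := radii_has_sup U x.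
move=> r /= [-> //|[/andP[r0 _] rU]]; exfalso; apply/Ux/rU.
exact: (@ballxx _ _ _ r).
Qed.

Lemma depth_lipschitz U : ball_lipschitz 1 (depth U).
Proof.
have half x y r : 0 < r -> ball x r y -> depth U x <= depth U y + r.
  move=> r0 xy; apply: ge_sup; first by have [] := radii_has_sup U x.
  move=> s /= [->|[/andP[s0 s1] sU]].
    by rewrite addr_ge0 ?depth_ge0// ltW.
  have [sr|rs] := leP s r; first by rewrite (le_trans sr)// lerDr depth_ge0.
  rewrite -lerBlDr; apply: ub_le_sup; first by have [] := radii_has_sup U y.
  right; split; first by rewrite subr_gt0 rs/=; lra.
  move=> z yz; apply: sU; rewrite (_ : s = r + (s - r)); last by lra.
  exact: ball_triangle xy yz.
move=> x y r r0 xy; rewrite mul1r ler_norml; apply/andP; split.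
  by have := half _ _ _ r0 (ball_sym xy); lra.
by have := half _ _ _ r0 xy; lra.
Qed.

(** Lipschitz functions that increase to the indicator of the open set [U]. *)
Definition ramp U n x : R := Num.min 1 (n%:R * depth U x).

Lemma ramp01 U n x : 0 <= ramp U n x <= 1.
Proof. by rewrite /ramp le_min ler01 ge_min lexx mulr_ge0// depth_ge0. Qed.

Lemma ramp_lipschitz U n : ball_lipschitz n%:R (ramp U n).
Proof.
move=> x y r r0 xy; have /ler_normlP[h1 h2] := depth_lipschitz U r0 xy.
have hn := @ler_wpM2l R n%:R (ler0n _ _) _ _.
have := hn _ _ h1; have := hn _ _ h2; rewrite !mulrBr !mulrN !mul1r => {}h1 {}h2.
rewrite /ramp /Num.min ler_norml.
by case: ltP => ?; case: ltP => ?; apply/andP; split; lra.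
Qed.

Lemma ramp_out U n x : ~ U x -> ramp U n x = 0.
Proof. by move=> Ux; rewrite /ramp depth_out// mulr0 min_r. Qed.

Lemma ramp_cvg U x : open U -> ramp U n x @[n --> \oo] --> (\1_U x : R).
Proof.
move=> oU; rewrite indicE; have [Ux|Ux] := pselect (U x); last first.
  rewrite memNset//= (_ : (fun n => _) = fun=> 0) ?cvg_cst//; first exact: cvg_cst.
  by apply/funext => n; exact: ramp_out.
rewrite mem_set//=; apply: cvg_near_cst; near=> n.
apply/min_idPl; rewrite -ler_pdivrMr ?depth_gt0// div1r.
by near: n; exact: nbhs_infty_ger.
Unshelve. all: by end_near. Qed.

Lemma ramp_continuous U n : continuous (ramp U n).
Proof. by apply: ball_lipschitz_continuous (ramp_lipschitz U n). Qed.

End depth.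

Section lipschitz_determine.
Context (R : realType) (T : pseudoPMetricType R).

Lemma ramp_integral_cvg (P : probability (borel T) R) (U : set T) : open U ->
  \int[P]_z ramp U n z @[n --> \oo] --> fine (P U).
Proof.
move=> oU.
have mr n : measurable_fun [set: borel T] (ramp U n).
  apply: continuous_borel_measurable; exact: ramp_continuous.
have mU : measurable (U : set (borel T)) by exact: open_borel.
have [_ _ h] : [/\ P.-integrable setT (fun z => (\1_U z : R)%:E),
    [sequence \int[P]_z (`|(ramp U n z)%:E - (\1_U z)%:E|)%E]_n @ \oo --> 0%E &
    [sequence \int[P]_z (ramp U n z)%:E]_n @ \oo --> \int[P]_z (\1_U z)%:E]%E.
  apply: (@dominated_convergence _ _ _ _ _ _ _ _ (cst 1%E)) => //.
  - by move=> n; exact/measurable_EFinP.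
  - by apply/measurable_EFinP; exact: measurable_indic.
  - apply: aeW => z _; apply: cvg_EFin; first by apply: nearW.
    exact: ramp_cvg.
  - exact: (finite_measure_integrable_cst P 1).
  - apply: aeW => z n _; rewrite lee_fin.
    by have /andP[? ?] := ramp01 U n z; rewrite ger0_norm.
rewrite integral_indic// setIT in h.
apply: fine_cvg; rewrite fine_probability//.
Qed.

Lemma lipschitz_determine (P Q : probability (borel T) R) :
  (forall k (f : T -> R), 0 <= k -> ball_lipschitz k f ->
    (forall z, 0 <= f z <= 1) -> \int[P]_z f z = \int[Q]_z f z) ->
  forall A : set (borel T), measurable A -> P A = Q A.
Proof.
move=> PQ; apply: (@measure_unique _ R (borel T) (@open T) (fun=> setT)) => //.
- by move=> A B; exact: openI.
- by move=> _; exact: openT.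
- by apply/seteqP; split => // z _; exists 0%N.
- move=> U oU.
  have e : fine (P U) = fine (Q U).
    apply: (cvg_unique _ (@ramp_integral_cvg P U oU)) => //.
    have := @ramp_integral_cvg Q U oU.
    rewrite (_ : (fun n => \int[Q]_z _) = fun n => \int[P]_z ramp U n z)//.
    apply/funext => n; apply/esym/(PQ n%:R) => //; first exact: ramp_lipschitz.
    by move=> z; exact: ramp01.
  have mU := open_borel oU.
  apply: etrans (fine_probability Q mU); rewrite -e.
  exact/esym/fine_probability.
- by move=> _; apply: (le_lt_trans (probability_le1 P measurableT)); rewrite ltry.
Qed.

End lipschitz_determine.

(** * Second countability *)

Lemma separable_seq (T : ptopologicalType) : separable T ->
  exists a : nat -> T, forall U : set T, open U -> U !=set0 -> exists n, U (a n).
Proof.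
move=> [D /countable_injP[f finj] dD].
exists (fun n => xget point [set c | D c /\ f c = n]) => U oU U0.
have [c [Uc Dc]] := dD U U0 oU; exists (f c).
have -> // : xget point [set c' | D c' /\ f c' = f c] = c.
case: xgetP => [c' _ [Dc' e]|/(_ c) []//].
by apply: finj; rewrite ?inE.
Qed.

Lemma separable_second_countable (R : realType) (T : pseudoPMetricType R) :
  separable T -> @second_countable T.
Proof.
move=> /separable_seq[a da].
pose b (p : nat * nat) : set T := (ball (a p.1) (p.2.+1%:R^-1 : R))^°.
exists (b @` setT).
  by apply: card_le_trans (card_image_le _ _) _; exact: countableP.
split; first by move=> _ [p _ <-]; exact: open_interior.
move=> x U /nbhs_ballP[e /= e0 eU].
have e20 : 0 < e / 2 by rewrite divr_gt0.
near \oo => j.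
have je : (j.+1%:R^-1 : R) <= e / 2.
  by apply: ltW; near: j; exact: (near_infty_natSinv_lt (PosNum e20)).
have j0 : 0 < j.+1%:R^-1 / 2 :> R by rewrite divr_gt0.
have [||n hn] := da (ball x (j.+1%:R^-1 / 2 : R))^°.
- exact: open_interior.
- by exists x; exact: nbhsx_ballx.
have xn := interior_subset hn.
exists (b (n, j)).
  split; first by exists (n, j).
  rewrite /b /=; apply: filterS (nbhsx_ballx x _ j0).
  move=> z xz; rewrite [X in ball _ X](splitr _); apply: ball_triangle xz.
  exact: ball_sym.
move=> z /= /interior_subset nz; apply: eU.
apply: (@le_ball _ _ _ (j.+1%:R^-1 / 2 + j.+1%:R^-1 : R)); last first.
  exact: ball_triangle nz.
by move: je j0; set u := _.+1%:R^-1; lra.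
Unshelve. all: by end_near. Qed.

Lemma open_setX (S T : topologicalType) (V : set S) (W : set T) :
  open V -> open W -> open (V `*` W).
Proof.
move=> oV oW; rewrite openE => -[x y] [/= Vx Wy].
by exists (V, W) => //; split; exact: open_nbhs_nbhs.
Qed.

Lemma prod_second_countable (S T : ptopologicalType) :
  @second_countable S -> @second_countable T -> @second_countable (S * T)%type.
Proof.
move=> /second_countable_seq[B [oB nB]] /second_countable_seq[C [oC nC]].
pose b (p : nat * nat) : set (S * T) := B p.1 `*` C p.2.
exists (b @` setT).
  by apply: card_le_trans (card_image_le _ _) _; exact: countableP.
split.
  by move=> _ [p _ <-]; apply: open_setX; [exact: oB|exact: oC].
move=> [x y] U [[V W] /= [nV nW] VWU].
have [m Bmx BmV] := nB x (V^°) (conj (open_interior V) nV).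
have [n Cny CnW] := nC y (W^°) (conj (open_interior W) nW).
exists (b (m, n)); first by split; [exists (m, n)|].
move=> [x' y'] [/= /BmV /interior_subset ? /CnW /interior_subset ?].
exact: VWU.
Qed.

(** Needed because the support of a product measure is tested on the open sets of
    the product topology, while the measure lives on the product sigma-algebra. *)
Lemma open_measurable_prod (S T : ptopologicalType) (U : set (S * T)) :
  @second_countable S -> @second_countable T -> open U ->
  measurable (U : set (borel S * borel T)).
Proof.
move=> /second_countable_seq[B [oB nB]] /second_countable_seq[C [oC nC]] oU.
pose F m n : set (borel S * borel T) :=
  if `[< B m `*` C n `<=` U >] then B m `*` C n else set0.
have -> : U = \bigcup_m \bigcup_n F m n.
  apply/seteqP; split=> [[x y] Uxy|z [m _ [n _]]]; last first.
    by rewrite /F; case: asboolP => // + ; apply.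
  have [[V W] /= [nV nW] VWU] : nbhs (x, y) U by exact: open_nbhs_nbhs.
  have [m Bmx BmV] := nB x (V^°) (conj (open_interior V) nV).
  have [n Cny CnW] := nC y (W^°) (conj (open_interior W) nW).
  exists m => //; exists n => //; rewrite /F asboolT//.
  by move=> [x' y'] [/= /BmV /interior_subset ? /CnW /interior_subset ?]; exact: VWU.
apply: bigcupT_measurable => m; apply: bigcupT_measurable => n.
rewrite /F; case: asboolP => // _.
by apply: measurableX; exact: open_borel.
Qed.

(** * Ultralimits of means *)

Section ultralimit.
Context (R : realType) (I T : Type).

Lemma ultra_fmap (J : Type) (G : set_system I) (h : I -> J) :
  UltraFilter G -> UltraFilter (h @ G).
Proof.
move=> GU; split; first exact: fmap_proper_filter.
move=> H HP sGH; apply/seteqP; split => // A HA.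
have [//|GnA] := in_ultra_setVsetC (h @^-1` A) GU.
have HnA : H (~` A) by apply: sGH.
exfalso; apply: (@filter_not_empty _ H HP).
by rewrite -(setICr A); exact: filterI.
Qed.

(** Along an ultrafilter every bounded family converges, so the limit of means
    exists on all bounded functions at once. *)
Lemma ultralimit_mean (F : set_system I) (v : I -> (T -> R) -> R) :
  ProperFilter F -> (forall i, is_mean (v i)) ->
  exists (G : set_system I) (L : (T -> R) -> R),
    [/\ ProperFilter G, F `<=` G, is_mean L &
        forall f, bdd f -> v ^~ f @ G --> L f].
Proof.
move=> FP mv; have [G [GU FG]] := ultraFilterLemma FP.
have cvgv f : bdd f -> cvg (v ^~ f @ G).
  move=> [M fM]; have bf : bdd f by exists M.
  have := @segment_compact R (- M) M; rewrite compact_ultra => /= cK.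
  have [|p [_ cp]] := cK (v ^~ f @ G) (ultra_fmap _ GU).
    change (G (v ^~ f @^-1` `[- M, M]%classic)).
    apply: filterE => i; rewrite /= in_itv/=; apply/andP; split.
      rewrite -(mean_cst (- M) (mv i)); apply: mean_le => //; first exact: bdd_cst.
      by move=> z; have := fM z; rewrite ler_norml => /andP[].
    rewrite -(mean_cst M (mv i)); apply: mean_le => //; first exact: bdd_cst.
    by move=> z; have := fM z; rewrite ler_norml => /andP[].
  by apply/cvg_ex; exists p.
pose L f : R := lim (v ^~ f @ G).
have vL f : bdd f -> v ^~ f @ G --> L f by move=> bf; exact: cvgv.
exists G, L; split => //.
- exact: ultra_proper.
- split.
  + move=> f g bf bg; apply: cvg_lim => //.
    rewrite (_ : (fun i => _) = fun i => v i f + v i g); last first.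
      by apply/funext => i; rewrite (meanD (mv i)).
    by apply: cvgD; exact: vL.
  + move=> c f bf; apply: cvg_lim => //.
    rewrite (_ : (fun i => _) = fun i => c * v i f); last first.
      by apply/funext => i; rewrite (meanZ (mv i)).
    by apply: cvgMr; exact: vL.
  + move=> f g bf bg fg; rewrite -subr_ge0.
    apply: cvgr_to_ge (cvgB (vL _ bg) (vL _ bf)) _; near=> i.
    by rewrite /= subr_ge0; apply: (mean_le (mv i)).
  + apply: cvg_lim => //.
    rewrite (_ : v^~ (fun=> 1) = fun=> 1); first exact: cvg_cst.
    by apply/funext => i; exact: (mean1 (mv i)).
Unshelve. all: by end_near. Qed.

End ultralimit.

(** * Couplings as limits of pairs of sequences *)

Section cover.
Context (R : realType) (T : pseudoPMetricType R).
Hypothesis sepT : separable T.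

(** Tightness of one probability, witnessed by a continuous function: this is the
    form that passes to limits of empirical averages, for which only integrals of
    continuous functions are controlled. *)
Lemma cheap_far (P : probability (borel T) R) (e d : R) : 0 < e -> 0 < d ->
  exists (s : seq T) (f : T -> R), [/\ continuous f, forall z, 0 <= f z <= 1,
    forall z, far s d z -> f z = 1 & \int[P]_z f z <= e].
Proof.
move=> e0 d0; have [a da] := separable_seq sepT.
pose V N : set T := \bigcup_(i in [set i | (i < N)%N]) (ball (a i) d)^°.
have oV N : open (V N) by apply: bigcup_open => i _; exact: open_interior.
have cvgV : P (V N) @[N --> \oo] --> 1%E.
  have <- : P (\bigcup_N V N) = 1%E.
    rewrite (_ : \bigcup_N V N = setT); first exact: probability_setT.
    apply/seteqP; split => // x _.
    have d20 : 0 < d / 2 by rewrite divr_gt0.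
    have [||n xn] := da (ball x (d / 2))^°.
    - exact: open_interior.
    - by exists x; exact: nbhsx_ballx.
    exists n.+1 => //; exists n => //=.
    apply: filterS (nbhsx_ballx x _ d20) => z xz.
    rewrite [X in ball _ X](splitr _); apply: ball_triangle xz.
    exact/ball_sym/(interior_subset xn).
  apply: nondecreasing_cvg_mu => //.
  - by move=> N; exact: open_borel.
  - by apply: open_borel; apply: bigcup_open => N _; exact: oV.
  - move=> m n mn; apply/subsetPset => z [i /= im zi]; exists i => //=.
    exact: leq_trans im mn.
have e20 : 0 < e / 2 by rewrite divr_gt0.
have cvgfV : fine (P (V N)) @[N --> \oo] --> (1 : R) by exact: fine_cvg.
have /cvgrPdist_le /(_ _ e20) [N _ /(_ N (leqnn _)) /= hN] := cvgfV.
have /cvgrPdist_le /(_ _ e20) [n _ /(_ n (leqnn _)) /= hn] :=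
  @ramp_integral_cvg _ _ P _ (oV N).
have cr : continuous (ramp (V N) n : T -> R) by exact: ramp_continuous.
have mr : measurable_fun [set: borel T] (ramp (V N) n : T -> R).
  exact: continuous_borel_measurable.
have br : bdd (ramp (V N) n : T -> R) by apply: bdd_01 => z; exact: ramp01.
exists [seq a i | i <- iota 0 N], (fun z => 1 - ramp (V N) n z); split.
- by move=> z; apply: cvgB; [exact: cvg_cst|exact: cr].
- by move=> z; have /andP[? ?] := ramp01 (V N) n z; apply/andP; split; lra.
- move=> z fz; rewrite ramp_out ?subr0// => -[i /= iN /interior_subset].
  by apply: fz; apply: map_f; rewrite mem_iota.
- rewrite RintegralB//; last 2 first.
  + by apply: bdd_integrable; [exact: measurable_cst|exact: bdd_cst].
  + exact: bdd_integrable.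
  rewrite (Rintegral_prob_cst P 1).
  by move: hN hn; rewrite !ler_norml => /andP[? ?] /andP[? ?]; lra.
Qed.

End cover.

Section marginal.
Context (R : realType) (S T : pseudoPMetricType R).
Variables (P : probability (borel S) R) (mu : probability (borel T) R).

Lemma marginal_of_lipschitz (h : S -> T) : continuous h ->
  (forall k (f : T -> R), 0 <= k -> ball_lipschitz k f ->
    (forall z, 0 <= f z <= 1) -> \int[P]_z f (h z) = \int[mu]_z f z) ->
  forall A : set (borel T), measurable A -> P (h @^-1` A) = mu A.
Proof.
move=> ch Ph.
pose h_mixin := isMeasurableFun.Build _ _ _ _ _ (continuous_borel_fun ch).
pose H : {mfun borel S >-> borel T} := HB.pack (h : borel S -> borel T) h_mixin.
apply: (@lipschitz_determine R T (distribution P H) mu) => k f k0 kf f01.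
rewrite -(Ph k f)// /Rintegral ge0_integral_distribution//.
  apply/measurable_EFinP; apply: continuous_borel_measurable.
  exact: ball_lipschitz_continuous kf.
by move=> z; rewrite lee_fin; have /andP[] := f01 z.
Qed.

End marginal.

(** Iterated limits, first in [n] and then in [k], are limits along this filter. *)
Definition iterated_eventually : set_system (nat * nat) :=
  [set A | \forall k \near \oo, \forall n \near \oo, A (k, n)].

Lemma iterated_eventually_proper : ProperFilter iterated_eventually.
Proof.
apply: Build_ProperFilter_ex.
  move=> A kA; near \oo => k; near \oo => n; exists (k, n).
  by near: n; near: k.
split.
- change (\forall k \near \oo, \forall n \near \oo, setT (k, n)).
  by apply: nearW => k; apply: nearW.
- rewrite /setI_closed /iterated_eventually /= => A B kA kB.
  change (\forall k \near \oo, \forall n \near \oo, (A `&` B) (k, n)).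
  apply: (filterS2 _ _ kA kB) => k nA nB.
  by apply: (filterS2 _ _ nA nB) => n An Bn; split.
- rewrite /iterated_eventually /= => A B AB kA.
  change (\forall k \near \oo, \forall n \near \oo, B (k, n)).
  apply: (filterS _ kA) => k nA.
  by apply: (filterS _ nA) => n; exact: AB.
Unshelve. all: by end_near. Qed.

Lemma average_gt0 (R : realType) (T : Type) (x : nat -> T) n (f : T -> R) :
  0 < average x n f -> exists i, 0 < f (x i).
Proof.
move=> h; apply: contrapT => nf; move: h; apply/negP; rewrite -leNgt.
rewrite /average mulr_ge0_le0 ?invr_ge0//; apply: sumr_le0 => i _.
by rewrite leNgt; apply/negP => h; apply: nf; exists i.
Qed.

(** The support is detected by bump functions, whose integrals can be read on the
    approximating averages. *)
Lemma supp_integral_gt0 (R : realType) (T : ptopologicalType)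
    (P : probability (borel T) R) (f : T -> R) z :
  continuous f -> (forall w, 0 <= f w <= 1) -> supp P z -> 0 < f z ->
  0 < \int[P]_w f w.
Proof.
move=> cf f01 sz fz.
pose V : set T := f @^-1` [set y | f z / 2 < y].
have oV : open V by apply: open_comp; [move=> w _; exact: cf|exact: open_gt].
have PV : (0 < P V)%E.
  by apply: sz; split => //; rewrite /V/=; lra.
have mV := open_borel oV.
have fPV : 0 < fine (P V) by rewrite -lte_fin fine_probability.
apply: (@lt_le_trans _ _ (\int[P]_w (f z / 2 * \1_V w))).
  rewrite RintegralZl ?Rintegral_indic ?mulr_gt0 ?divr_gt0//.
  apply: bdd_integrable; [exact: measurable_indic|exact: bdd_indic].
apply: le_Rintegral => //.
- apply: bdd_integrable; last by apply: bddZ; exact: bdd_indic.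
  apply: measurable_funM; [exact: measurable_cst|exact: measurable_indic].
- apply: bdd_integrable; last exact: bdd_01.
  exact: continuous_borel_measurable.
- move=> w _; rewrite indicE; case: (boolP (w \in V)) => [|_].
    by rewrite inE mulr1 => /ltW.
  by rewrite mulr0; have /andP[] := f01 w.
Qed.

Lemma weak_cvg_average (R : realType) (T : ptopologicalType) (t : nat -> T)
  (P : probability (borel T) R) (f : T -> R) : weak_cvg (@empirical R T t) P ->
  continuous f -> (forall w, 0 <= f w <= 1) ->
  average t n.+1 f @[n --> \oo] --> \int[P]_w f w.
Proof.
move=> tP cf f01.
have mf : measurable_fun [set: borel T] f by exact: continuous_borel_measurable.
have bf : bounded_fun f.
  exists 1; split => //.
  move=> M M1 w _; have /andP[f0 f1] := f01 w.
  by apply: le_trans (ltW M1); rewrite /= ger0_norm.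
have := tP f cf bf.
rewrite EFin_Rintegral//; last exact: bdd_01.
under eq_fun do rewrite integral_empirical//.
move=> /fine_cvg h.
by have /= := h; rewrite -(cvg_shiftS (fun n => average t n f)).
Qed.

Section coupling_of_sequences.
Context (R : realType) (X Y : polishType R).
Variables (mu : probability (borel X) R) (nu : probability (borel Y) R).
Variables (x : nat -> nat -> X) (y : nat -> nat -> Y).
Hypothesis xmu : forall k, weak_cvg (@empirical R X (x k)) mu.
Hypothesis ynu : forall k, weak_cvg (@empirical R Y (y k)) nu.

Let z k i : X * Y := (x k i, y k i).

(** Compactness of the set of couplings, in the form needed here. The mean is the
    ultralimit of the empirical averages of the pairs. It is tight since its two
    marginals are, hence represented by a Borel probability [P], whose marginals
    agree with [mu] and [nu] on Lipschitz functions. A bump around a point of the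
    support of [P] has positive mean, so it is positive at some pair of the
    [k]-th sequence for many [k]; two bumps can be served by the same [k], which
    is essential as the cost compares two pairs of one sequence. *)
Theorem coupling_of_sequences : exists P : probability (borel (X * Y)%type) R,
  couplings mu nu P /\
  forall (E : set nat), (\forall k \near \oo, E k) ->
  forall (p q : X * Y) (e : R), supp P p -> supp P q -> 0 < e ->
  exists k i j, [/\ E k, ball p e (z k i) & ball q e (z k j)].
Proof.
have FP := iterated_eventually_proper.
pose v (kn : nat * nat) (f : X * Y -> R) := average (z kn.1) kn.2.+1 f.
have mv kn : is_mean (v kn) by exact: average_is_mean.
have [G [L [GP FG mL vL]]] := ultralimit_mean FP mv.
have LE (f : X * Y -> R) (a : R) : bdd f ->
    (forall k, average (z k) n.+1 f @[n --> \oo] --> a) -> L f = a.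
  move=> bf fa; apply: (cvg_unique _ (vL f bf)) => //.
  apply: cvg_trans (_ : v ^~ f @ iterated_eventually --> a); first exact: cvg_app.
  move=> A Aa; apply: nearW => k; exact: fa k A Aa.
have Lfst (f : X -> R) : continuous f -> (forall w, 0 <= f w <= 1) ->
    L (fun w => f w.1) = \int[mu]_w f w.
  move=> cf f01; apply: LE; first by apply: bdd_01 => w; exact: f01.
  by move=> k; exact: (weak_cvg_average (xmu k) cf f01).
have Lsnd (f : Y -> R) : continuous f -> (forall w, 0 <= f w <= 1) ->
    L (fun w => f w.2) = \int[nu]_w f w.
  move=> cf f01; apply: LE; first by apply: bdd_01 => w; exact: f01.
  by move=> k; exact: (weak_cvg_average (ynu k) cf f01).
have tL : tight L.
  move=> e d e0 d0; have e20 : 0 < e / 2 by rewrite divr_gt0.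
  have [s [f [cf f01 fs fe]]] := cheap_far (@separableT _ X) mu e20 d0.
  have [t [g [cg g01 gt ge]]] := cheap_far (@separableT _ Y) nu e20 d0.
  have bf : bdd (fun w : X * Y => f w.1) by apply: bdd_01 => w; exact: f01.
  have bg : bdd (fun w : X * Y => g w.2) by apply: bdd_01 => w; exact: g01.
  exists [seq (a, b) | a <- s, b <- t].
  apply: le_trans (_ : L (fun w => f w.1 + g w.2) <= e); last first.
    by rewrite (meanD mL)// Lfst// Lsnd// (splitr e) lerD.
  apply: mean_le => //; [exact: bdd_indic|exact: bddD|].
  move=> -[a b]; rewrite indicE; case: (boolP (_ \in _)) => [|_] /=; last first.
    by have /andP[? _] := f01 a; have /andP[? _] := g01 b; rewrite addr_ge0.
  rewrite inE => fab; have /andP[? _] := f01 a; have /andP[? _] := g01 b.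
  have [fa|] := pselect (far s d a); first by rewrite (fs _ fa) lerDl.
  move=> /existsNP[c /not_implyP[cs /contrapT ca]].
  rewrite gt ?lerDr// => c' c't bc'.
  apply: (fab (c, c')); first by apply/allpairsP; exists (c, c').
  by split.
have [P PL] := tight_mean_riesz mL tL.
have PL' k f : 0 <= k -> ball_lipschitz k f -> (forall w, 0 <= f w <= 1) ->
    \int[P]_w f w = L f.
  by move=> k0 kf f01; rewrite /Rintegral (PL k).
exists P; split.
  split.
  - apply: (marginal_of_lipschitz (h := fst)); first by move=> w; exact: cvg_fst.
    move=> k f k0 kf f01; rewrite (PL' k)//.
    + by apply: Lfst => //; exact: ball_lipschitz_continuous kf.
    + exact: lipschitz_fst.
  - apply: (marginal_of_lipschitz (h := snd)); first by move=> w; exact: cvg_snd.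
    move=> k f k0 kf f01; rewrite (PL' k)//.
    + by apply: Lsnd => //; exact: ball_lipschitz_continuous kf.
    + exact: lipschitz_snd.
move=> E nE p q e sp sq e0.
pose bump (p : X * Y) : X * Y -> R := depth (ball p e)^°.
have bump01 r w : 0 <= bump r w <= 1 by rewrite depth_ge0 depth_le1.
have Lbump r : supp P r -> 0 < L (bump r).
  move=> sr; rewrite -(PL' 1)//; last exact: depth_lipschitz.
  apply: (supp_integral_gt0 _ _ sr) => //.
  - by apply: ball_lipschitz_continuous (depth_lipschitz _).
  - apply: depth_gt0; first exact: open_interior.
    exact: nbhsx_ballx.
have nL r : supp P r -> \forall kn \near G, 0 < v kn (bump r).
  move=> sr; have := vL _ (bdd_01 (bump01 r)).
  by move=> /cvgr_gt /(_ _ (Lbump r sr)).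
have nE' : \forall kn \near G, E kn.1.
  by apply: FG; apply: filterS nE => k Ek; apply: nearW.
have [kn [Ek vp vq]] : exists kn : nat * nat,
    [/\ E kn.1, 0 < v kn (bump p) & 0 < v kn (bump q)].
  by apply: (@filter_ex _ G); apply: filterS3 nE' (nL p sp) (nL q sq).
have bumpB r w : 0 < bump r w -> ball r e w.
  move=> h; apply: interior_subset; apply: contrapT => nw.
  by move: h; rewrite /bump depth_out// ltxx.
have [i hi] := average_gt0 vp; have [j hj] := average_gt0 vq.
by exists kn.1, i, j; split => //; exact: bumpB.
Qed.

End coupling_of_sequences.

(** * Comparison of the two costs *)

Lemma supp_product (R : realType) (Z : ptopologicalType)
    (P : probability (borel Z) R) (p q : Z) : @second_countable Z ->
  @supp R (Z * Z)%type (P \x P)%E (p, q) <-> supp P p /\ supp P q.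
Proof.
move=> scZ; split=> [spq|[sp sq] W [oW Wpq]].
  split=> U [oU Uz].
    have := spq (U `*` setT).
    rewrite product_measure1E//; last exact: open_borel.
    rewrite [X in (_ * X)%E](_ : _ = 1%E); last exact: probability_setT.
    by rewrite mule1; apply; split => //; apply: open_setX => //; exact: openT.
  have := spq (setT `*` U).
  rewrite product_measure1E//; last exact: open_borel.
  rewrite [X in (X * _)%E](_ : _ = 1%E); last exact: probability_setT.
  by rewrite mul1e; apply; split => //; apply: open_setX => //; exact: openT.
have [[U V] /= [nU nV] UVW] : nbhs (p, q) W by exact: open_nbhs_nbhs.
have oU := open_interior U; have oV := open_interior V.
apply: (@lt_le_trans _ _ ((P \x P)%E (U^° `*` V^°))).
  rewrite product_measure1E; [|exact: open_borel|exact: open_borel].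
  by apply: mule_gt0; [exact: sp|exact: sq].
apply: le_measure; rewrite ?inE.
- by apply: measurableX; exact: open_borel.
- exact: open_measurable_prod.
- by move=> [a b] [/= /interior_subset Ua /interior_subset Vb]; exact: UVW.
Qed.

Lemma half_ereal_sup_le (R : realType) (S : set (\bar R)) (r : R) :
  (forall s, S s -> (s <= (2 * r)%:E)%E) ->
  ((2^-1)%:E * ereal_sup S <= r%:E)%E.
Proof.
move=> Sr; have := ge_ereal_sup Sr.
rewrite -(@lee_pmul2l _ (2^-1)%:E) ?lte_fin ?invr_gt0//.
by rewrite -EFinM mulKf.
Qed.

(** Treats finite and infinite infima alike, through real upper bounds. *)
Lemma le_ereal_approx (R : realType) (a c : \bar R) :
  (forall r : R, (c < r%:E)%E -> (a <= r%:E)%E) -> (a <= c)%E.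
Proof.
case: c => [c| |] h; last 2 first.
- exact: leey.
- case: a h => [s| |] h //.
    by have := h (s - 1) (ltNyr _); rewrite lee_fin => ?; exfalso; lra.
  by have := h 0 (ltNyr _).
by apply/lee_addgt0Pr => e e0; rewrite -EFinD; apply: h; rewrite lte_fin ltrDl.
Qed.

Lemma unif_seq_of_coupling (T Z : ptopologicalType) (R : realType)
    (P : probability (borel Z) R) (mu : probability (borel T) R)
    (h : Z -> T) (z : nat -> Z) : continuous h ->
  (forall A : set (borel T), measurable A -> P (h @^-1` A) = mu A) ->
  weak_cvg (@empirical R Z z) P -> weak_cvg (@empirical R T (h \o z)) mu.
Proof.
move=> ch Pmu zP f cf bf.
have mf : measurable_fun [set: borel T] f by exact: continuous_borel_measurable.
have cfh : continuous (f \o h).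
  by move=> w; apply: continuous_comp; [exact: ch|exact: cf].
have mfh : measurable_fun [set: borel Z] (f \o h).
  exact: continuous_borel_measurable.
have [M fM] := bounded_fun_bdd bf.
have bfh : bounded_fun (f \o h).
  exists M; split; first exact: num_real.
  by move=> N MN w _; exact: le_trans (fM _) (ltW MN).
have := zP (f \o h) cfh bfh.
have empE n : (\int[@empirical R Z z n]_w ((f \o h) w)%:E =
    \int[@empirical R T (h \o z) n]_w (f w)%:E)%E.
  by rewrite !integral_empirical.
rewrite (funext empE).
suff -> : (\int[P]_w ((f \o h) w)%:E = \int[mu]_w (f w)%:E)%E by [].
pose h_mixin := isMeasurableFun.Build _ _ _ _ _ (continuous_borel_fun ch).
pose H : {mfun borel Z >-> borel T} := HB.pack (h : borel Z -> borel T) h_mixin.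
rewrite -[LHS](@integral_distribution _ _ _ _ _ P H (EFin \o f)).
- by apply: eq_measure_integral => A mA _; exact: Pmu.
- exact/measurable_EFinP.
- by apply: (bdd_integrable P mfh); exists M => w; exact: fM.
Qed.

Lemma mdist_perturb (R : realType) (T : metricType R) (e : R) (a a' b b' : T) :
  ball a e a' -> ball b e b' -> `|mdist a b - mdist a' b'| <= 2 * e.
Proof.
rewrite !ballEmdist /= => aa bb.
have := metric_triangle a a' b; have := metric_triangle a' b' b.
have := metric_triangle a' a b'; have := metric_triangle a b b'.
rewrite (metric_sym a' a) (metric_sym b' b) ler_norml => *.
by apply/andP; split; lra.
Qed.

Section comparison.
Context (R : realType) (B : polishType R) (X Y : mmField B).

Lemma polish_prod_second_countable : @second_countable (X * Y)%type.
Proof.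
by apply: prod_second_countable; apply: (separable_second_countable (R := R));
  exact: separableT.
Qed.

(** The pairs are drawn from the support of [P], and pairs of such pairs then lie
    in the support of [P \x P], so each term of the cost of the sequences occurs
    in the cost of [P]. *)
Lemma seq_cost_le_coupling_cost (P : probability (borel (X * Y)%type) R) :
  couplings (mm_meas X) (mm_meas Y) P ->
  exists (x : nat -> X) (y : nat -> Y),
    [/\ unif_seq x, unif_seq y & (seq_cost x y <= coupling_cost P)%E].
Proof.
move=> [Pfst Psnd].
have sc := polish_prod_second_countable.
have [z [zs zP]] := unif_seq_in_supp P sc.
exists (fst \o z), (snd \o z); split.
- by apply: (unif_seq_of_coupling _ Pfst zP) => w; exact: cvg_fst.
- by apply: (unif_seq_of_coupling _ Psnd zP) => w; exact: cvg_snd.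
rewrite /seq_cost /coupling_cost ge_max !le_max; apply/andP; split.
  apply/orP; left; rewrite lee_pmul2l ?lte_fin ?invr_gt0//.
  apply: ereal_sup_le => _ [[i j] _ <-].
  by exists (z i, z j) => //; apply/supp_product.
apply/orP; right; apply: ereal_sup_le => _ [i _ <-].
by exists (z i) => //; exact: zs.
Qed.

Lemma seq_cost_lt_bounds (x : nat -> X) (y : nat -> Y) (r : R) :
  (seq_cost x y < r%:E)%E ->
  (forall i j, mXY (x i) (y i) (x j) (y j) <= 2 * r) /\
  (forall i, dXY (x i) (y i) <= r).
Proof.
rewrite /seq_cost gt_max => /andP[h1 h2]; split => [i j|i].
  rewrite -ler_pdivrMl// -lee_fin (le_trans _ (ltW h1))//.
  rewrite EFinM lee_pmul2l ?lte_fin ?invr_gt0//.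
  by apply: ereal_sup_ubound; exists (i, j).
rewrite -lee_fin (le_trans _ (ltW h2))//.
by apply: ereal_sup_ubound; exists i.
Qed.

(** The coupling is a limit of pairs of sequences whose costs tend to the infimum:
    two points of its support are approximated by pairs of one of these sequences,
    of cost arbitrarily close to the infimum. *)
Lemma coupling_cost_le_seq_inf :
  exists P : probability (borel (X * Y)%type) R,
    couplings (mm_meas X) (mm_meas Y) P /\
    (coupling_cost P <= ereal_inf [set seq_cost p.1 p.2
      | p in [set p : (nat -> X) * (nat -> Y) | unif_seq p.1 /\ unif_seq p.2]])%E.
Proof.
set C := (X in ereal_inf X).
have scX : @second_countable X.
  by apply: (separable_second_countable (R := R)); exact: separableT.
have scY : @second_countable Y.
  by apply: (separable_second_countable (R := R)); exact: separableT.
have C0 : C != set0.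
  have [x [_ xmu]] := unif_seq_in_supp (mm_meas X) scX.
  have [y [_ ynu]] := unif_seq_in_supp (mm_meas Y) scY.
  by apply/set0P; exists (seq_cost x y); exists (x, y).
have [u uC ucvg] := ereal_inf_seq C0.
have /choice[p hp] : forall k, exists p : (nat -> X) * (nat -> Y),
    (unif_seq p.1 /\ unif_seq p.2) /\ seq_cost p.1 p.2 = u k.
  by move=> k; have [p hp <-] := uC k; exists p.
have [P [PC Ps]] := coupling_of_sequences
  (fun k => (hp k).1.1) (fun k => (hp k).1.2).
exists P; split => //; apply: le_ereal_approx => r cr.
pose E := [set k | (u k < r%:E)%E].
have nE : \forall k \near \oo, E k by exact: ucvg _ (open_ereal_lt' cr).
have close (e : R) (z w : X * Y) : 0 < e -> supp P z -> supp P w ->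
    mXY z.1 z.2 w.1 w.2 <= 2 * r + 4 * e /\ dXY z.1 z.2 <= r + 2 * e.
  move=> e0 sz sw.
  have [k [i [j [Ek [zi1 zi2] [wj1 wj2]]]]] := Ps E nE z w e sz sw e0.
  have ck : (seq_cost (p k).1 (p k).2 < r%:E)%E by rewrite (hp k).2.
  have [h1 h2] := seq_cost_lt_bounds ck.
  have := h1 i j; have := h2 i; rewrite /mXY /dXY => d2 d1.
  have m1 := mdist_perturb zi1 wj1; have m2 := mdist_perturb zi2 wj2.
  split.
    rewrite /mXY; move: d1 m1 m2; rewrite !ler_norml.
    move=> /andP[? ?] /andP[? ?] /andP[? ?].
    by apply/andP; split; lra.
  have lip (Z : mmField B) (a b : Z) : ball a e b ->
      mdist (mm_proj a) (mm_proj b) < e.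
    by rewrite ballEmdist /=; apply: le_lt_trans; exact: mm_proj_lip.
  have dX : mdist (mm_proj z.1) (mm_proj ((p k).1 i)) < e by exact: lip zi1.
  have dY : mdist (mm_proj z.2) (mm_proj ((p k).2 i)) < e by exact: lip zi2.
  rewrite /dXY; apply: le_trans (metric_triangle _ (mm_proj ((p k).1 i)) _) _.
  have := metric_triangle (mm_proj ((p k).1 i)) (mm_proj ((p k).2 i)) (mm_proj z.2).
  by rewrite metric_sym in dY; lra.
rewrite /coupling_cost ge_max; apply/andP; split.
  apply: half_ereal_sup_le => _ [[z w] /= szw <-].
  have [sz sw] := (supp_product _ _ _ polish_prod_second_countable).1 szw.
  rewrite lee_fin; apply/ler_addgt0Pr => e e0.
  have e40 : 0 < e / 4 by rewrite divr_gt0.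
  by have [+ _] := close _ _ _ e40 sz sw; lra.
apply: ge_ereal_sup => _ [z sz <-]; rewrite lee_fin; apply/ler_addgt0Pr => e e0.
have e20 : 0 < e / 2 by rewrite divr_gt0.
by have [_ +] := close _ _ _ e20 sz sz; lra.
Qed.

End comparison.

Theorem theorem5p6 (R : realType) (B : polishType R) (X Y : mmField B)
    (boundedX : bounded_mmField X) (boundedY : bounded_mmField Y) :
  dGWoo X Y =
    ereal_inf [set seq_cost p.1 p.2
              | p in [set p : (nat -> X) * (nat -> Y)
                     | unif_seq p.1 /\ unif_seq p.2]] /\
  (exists (x : nat -> X) (y : nat -> Y),
    [/\ unif_seq x, unif_seq y &
        seq_cost x y =
          ereal_inf [set seq_cost p.1 p.2
                    | p in [set p : (nat -> X) * (nat -> Y)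
                           | unif_seq p.1 /\ unif_seq p.2]]]).
Proof.
set C := [set _ | _ in _].
have [P [PC Pc]] := coupling_cost_le_seq_inf X Y; rewrite -/C in Pc.
split.
  apply/eqP; rewrite eq_le; apply/andP; split.
    by apply: le_trans Pc; apply: ereal_inf_lbound; exists P.
  apply: le_ereal_inf_tmp => _ [Q QC <-].
  have [x [y [xU yU]]] := seq_cost_le_coupling_cost QC.
  by apply: le_trans; apply: ereal_inf_lbound; exists (x, y).
have [x [y [xU yU xyP]]] := seq_cost_le_coupling_cost PC.
exists x, y; split => //; apply/eqP; rewrite eq_le (le_trans xyP Pc)/=.
by apply: ereal_inf_lbound; exists (x, y).
Qed.
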